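(* Consider the multitime hybrid differential game with running costs $L_\alpha$, dynamics $X^i_\alpha$ ($i=1,\dots,n$, $\alpha=1,\dots,m$), terminal cost $g$ and terminal multitime $T$ described in the context, with multitime upper value function $M$ and multitime lower value function $m$. (i) The multitime upper value function $M(t,x)$ is a viscosity solution of the multitime upper PDE system $$\frac{\partial M}{\partial t^\alpha}(t,x)+\min_{v_\alpha\in \mathcal{V}} \max_{u_\alpha\in \mathcal{U}} \left\lbrace \sum_{i=1}^n \frac{\partial M}{\partial x^i}(t,x)\, X_\alpha^i(t,x,u_\alpha,v_\alpha)+L_\alpha(t,x,u_\alpha,v_\alpha)\right\rbrace =0,\qquad \alpha=1,\dots,m,$$ and satisfies the terminal condition $M(T,x)=g(x)$ for all $x\in\mathbb{R}^n$. (ii) The multitime lower value function $m(t,x)$ is a viscosity solution of the multitime lower PDE system $$\frac{\partial m}{\partial t^\alpha}(t,x)+\max_{u_\alpha \in \mathcal{U}} \min_{v_\alpha \in \mathcal{V}} \left\lbrace \sum_{i=1}^n \frac{\partial m}{\partial x^i}(t,x)\, X_\alpha^i(t,x,u_\alpha,v_\alpha)+L_\alpha(t,x,u_\alpha,v_\alpha)\right\rbrace =0,\qquad \alpha=1,\dots,m,$$ and satisfies the terminal condition $m(T,x)=g(x)$ for all $x\in\mathbb{R}^n$.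
   Context: Multitimes. Let $m,n\ge 1$ be integers and $T=(T^1,\dots,T^m)\in\mathbb{R}^m_+$ with all $T^\alpha>0$. For $t,\tau\in\mathbb{R}^m_+$ with $t^\alpha\le\tau^\alpha$ for all $\alpha$, let $\Omega_{t\tau}=\{s\in\mathbb{R}^m: t^\alpha\le s^\alpha\le\tau^\alpha \text{ for all }\alpha\}$, and let $\Gamma_{t\tau}$ denote an increasing (each component nondecreasing) piecewise $C^1$ curve in $\Omega_{t\tau}$ from $t$ to $\tau$. In curvilinear integrals $\int_\Gamma \Lambda_\alpha\,ds^\alpha$ the repeated index $\alpha$ is summed from $1$ to $m$. (The letter $m$ also denotes the lower value function; the meaning is clear from the arguments.) Data. $\mathcal{U}$ and $\mathcal{V}$ are compact sets of control values (each $u_\alpha$ ranges over $\mathcal U\subset\mathbb{R}^p$, each $v_\alpha$ over $\mathcal V\subset\mathbb{R}^q$). For each $\alpha=1,\dots,m$, the functions $X_\alpha=(X^i_\alpha)_{i=1}^n:\Omega_{0T}\times\mathbb{R}^n\times \mathcal U\times \mathcal V\to\mathbb{R}^n$ and $L_\alpha:\Omega_{0T}\times\mathbb{R}^n\times \mathcal U\times \mathcal V\to\mathbb{R}$ are bounded and uniformly continuous, with $X_\alpha$ and $L_\alpha$ Lipschitz in $x$ uniformly in the other variables, and $g:\mathbb{R}^n\to\mathbb{R}$ is bounded and Lipschitz. Controls. For $t\in\Omega_{0T}$, $U(t)$ (resp. $V(t)$) is the set of Borel measurable $u=(u_\alpha)_{\alpha=1}^m$ (resp. $v=(v_\alpha)_{\alpha=1}^m$)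 on $\Omega_{tT}$ with each $u_\alpha(s)\in \mathcal U$ (resp. $v_\alpha(s)\in \mathcal V$). Dynamics and payoff. For $(t,x)\in\Omega_{0T}\times\mathbb{R}^n$, $u\in U(t)$, $v\in V(t)$, the state $x(\cdot)$ solves the Cauchy problem $$\frac{\partial x^i}{\partial s^\alpha}(s)=X^i_\alpha(s,x(s),u_\alpha(s),v_\alpha(s)),\quad x(t)=x,\quad s\in\Omega_{tT},$$ understood as $x^i(s)=x^i+\int_{\Gamma_{ts}}X^i_\alpha\,d\sigma^\alpha$ along every increasing curve. Standing assumptions: the evolution is an $m$-flow, i.e. for all such $u,v$ this problem is completely integrable and has a unique solution, and the curvilinear integral (mechanical work) in the payoff $$J_{t,x}(u,v)=\int_{\Gamma_{tT}}L_\alpha(s,x(s),u_\alpha(s),v_\alpha(s))\,ds^\alpha+g(x(T))$$ is path independent. The $u$-team maximizes and the $v$-team minimizes. Strategies. A strategy of the $u$-team at $t$ is a nonanticipating map $\Phi:V(t)\to U(t)$: if $v=\tilde v$ on $\Omega_{t\tau}$ then $\Phi[v]=\Phi[\tilde v]$ on $\Omega_{t\tau}$, for every $\tau\in\Omega_{tT}$. Their set is $\mathcal{A}(t)$. A strategy of the $v$-team is likewise a nonanticipating map $\Psi:U(t)\to V(t)$; their set is $\mathcal{B}(t)$. Value functions (min and max over strategies and control functions are read as infimum and supremum): $$M(t,x)=\max_{\Phi\in\mathcal{A}(t)}\ \min_{v\in V(t)}J_{t,x}(\Phi[v],v)\quad\text{(multitime upper value)},$$ $$m(t,x)=\min_{\Psi\in\mathcal{B}(t)}\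 \max_{u\in U(t)}J_{t,x}(u,\Psi[u])\quad\text{(multitime lower value)}.$$ Viscosity solution. Given Hamiltonians $H_\alpha(t,x,p)$, $\alpha=1,\dots,m$, a function $w:\Omega_{0T}\times\mathbb{R}^n\to\mathbb{R}$ is a viscosity solution of the system $\frac{\partial w}{\partial t^\alpha}+H_\alpha\left(t,x,\frac{\partial w}{\partial x}\right)=0$, $\alpha=1,\dots,m$, if for every $\omega\in C^1(\Omega_{0T}\times\mathbb{R}^n)$ and every $(t,x)\in\Omega_{0T}\times\mathbb{R}^n$ with $t^\alpha<T^\alpha$ for all $\alpha$: if $w-\omega$ has a local maximum at $(t,x)$, then $\frac{\partial\omega}{\partial t^\alpha}(t,x)+H_\alpha\left(t,x,\frac{\partial\omega}{\partial x}(t,x)\right)\ge0$ for each $\alpha$; if $w-\omega$ has a local minimum at $(t,x)$, then $\frac{\partial\omega}{\partial t^\alpha}(t,x)+H_\alpha\left(t,x,\frac{\partial\omega}{\partial x}(t,x)\right)\le0$ for each $\alpha$. *)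

(* Defs.v *)
From mathcomp Require Import all_boot all_order all_algebra.
From mathcomp Require Import all_classical all_reals all_analysis.

Set Implicit Arguments.
Unset Strict Implicit.
Unset Printing Implicit Defensive.

Import Order.TTheory GRing.Theory Num.Theory.
Import numFieldNormedType.Exports.

Local Open Scope classical_set_scope.
Local Open Scope ring_scope.

Section Multitime.
Context {R : realType} {m : nat}.
Implicit Types (s t tau : 'rV[R]_m) (gamma : R -> 'rV[R]_m).
Implicit Types (F : 'I_m -> 'rV[R]_m -> R).

(* The hyper-parallelepiped Omega_{t tau}. *)
Definition box t tau : set 'rV[R]_m :=
  [set s | forall a, t 0 a <= s 0 a <= tau 0 a].

(* f is C^1 on [a, b] up to the end points. *)
Definition C1_on (a b : R) (f : R -> R) : Prop :=
  {within `[a, b], continuous f} /\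
  exists2 df : R -> R, {within `[a, b], continuous df}
    & forall r, a < r < b -> is_derive r 1 f (df r).

(* Increasing piecewise C^1 curves from t to tau, parameterized by [0, 1];
   their image lies in box t tau by monotonicity. *)
Definition increasing_curve t tau gamma : Prop :=
  [/\ gamma 0 = t,
      gamma 1 = tau,
      forall a r r', 0 <= r -> r <= r' -> r' <= 1 ->
        gamma r 0 a <= gamma r' 0 a
    & exists2 br : seq R, itv_partition 0 1 br &
        forall a k, (k < size br)%N ->
          C1_on (nth 0 (0 :: br) k) (nth 0 br k) (fun r => gamma r 0 a)].

Definition segment t tau : R -> 'rV[R]_m := fun r => t + r *: (tau - t).

(* The pullback of F_a ds^a (no summation).  The derivative of gamma may fail
   to exist at finitely many points, which does not affect integrals. *)
Definition line_integrand F gamma (a : 'I_m) (r : R) : R :=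
  F a (gamma r) * derive1 (fun r' => gamma r' 0 a) r.

Definition line_integrable F gamma : Prop :=
  forall a, (@lebesgue_measure R).-integrable `[0, 1]
              (EFin \o line_integrand F gamma a).

Definition line_integral F gamma : R :=
  \sum_a \int[@lebesgue_measure R]_(r in `[0, 1]) line_integrand F gamma a r.

Definition path_independent F t tau : Prop :=
  exists c, forall gamma, increasing_curve t tau gamma ->
    line_integrable F gamma /\ line_integral F gamma = c.

End Multitime.

Definition dot {R : realType} {k : nat} (x y : 'rV[R]_k) : R :=
  \sum_i x 0 i * y 0 i.

(* Borel measurability of f on D, for the sigma-algebras generated by the open
   sets of R^k and R^l. *)
Definition borel_fun {R : realType} {k l : nat} (D : set 'rV[R]_k)
    (f : 'rV[R]_k -> 'rV[R]_l) : Prop :=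
  @measurable_fun _ _ (g_sigma_algebraType (@open 'rV[R]_k))
    (g_sigma_algebraType (@open 'rV[R]_l)) D f.

(* Functions are total; only their values for times in box 0 horizon and
   control values in uvals, vvals are meaningful. *)
Record game (R : realType) (m n p q : nat) := Game {
  horizon : 'rV[R]_m;
  uvals : set 'rV[R]_p;
  vvals : set 'rV[R]_q;
  dyn : 'I_m -> 'rV[R]_m -> 'rV[R]_n -> 'rV[R]_p -> 'rV[R]_q -> 'rV[R]_n;
  cost : 'I_m -> 'rV[R]_m -> 'rV[R]_n -> 'rV[R]_p -> 'rV[R]_q -> R;
  terminal : 'rV[R]_n -> R
}.

Section Game.
Context {R : realType} {m n p q : nat}.
Variable G : game R m n p q.
Local Notation time := 'rV[R]_m.
Local Notation space := 'rV[R]_n.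
Local Notation uctrl := ('I_m -> time -> 'rV[R]_p).
Local Notation vctrl := ('I_m -> time -> 'rV[R]_q).
Local Notation T := (horizon G).
Implicit Types (t tau s : time) (x : space) (u : uctrl) (v : vctrl).

Section Regularity.
Context {W : normedModType R}.
Variable F : time -> space -> 'rV[R]_p -> 'rV[R]_q -> W.

Definition data_bounded : Prop :=
  exists C : R, forall t x b c,
    box 0 T t -> uvals G b -> vvals G c -> `|F t x b c| <= C.

Definition data_unif_continuous : Prop :=
  forall e : R, 0 < e -> exists2 d : R, 0 < d &
    forall t x b c t' x' b' c',
      box 0 T t -> uvals G b -> vvals G c ->
      box 0 T t' -> uvals G b' -> vvals G c' ->
      `|t - t'| < d -> `|x - x'| < d -> `|b - b'| < d -> `|c - c'| < d ->
      `|F t x b c - F t' x' b' c'| < e.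

Definition data_lipschitz : Prop :=
  exists K : R, forall t x x' b c,
    box 0 T t -> uvals G b -> vvals G c ->
    `|F t x b c - F t x' b c| <= K * `|x - x'|.

End Regularity.

Definition U t : set uctrl :=
  [set u | forall a, borel_fun (box t T) (u a) /\
                     forall s, box t T s -> uvals G (u a s)].

Definition V t : set vctrl :=
  [set v | forall a, borel_fun (box t T) (v a) /\
                     forall s, box t T s -> vvals G (v a s)].

Definition eq_ctrl_on (D : set time) k (u u' : 'I_m -> time -> 'rV[R]_k) :=
  forall a s, D s -> u a s = u' a s.

Definition trajectory t x u v (y : time -> space) : Prop :=
  forall s, box t T s ->
  forall gamma, increasing_curve t s gamma ->
  forall i, let F a r := dyn G a r (y r) (u a r) (v a r) 0 i in
    line_integrable F gamma /\ y s 0 i = x 0 i + line_integral F gamma.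

Definition m_flow : Prop :=
  forall t x u v, box 0 T t -> U t u -> V t v ->
  exists2 y, trajectory t x u v y &
    forall y', trajectory t x u v y' -> forall s, box t T s -> y' s = y s.

Definition running_cost u v (y : time -> space) : 'I_m -> time -> R :=
  fun a s => cost G a s (y s) (u a s) (v a s).

Definition work_path_independent : Prop :=
  forall t x u v y, box 0 T t -> U t u -> V t v -> trajectory t x u v y ->
    path_independent (running_cost u v y) t T.

Record standing_assumptions : Prop := StandingAssumptions {
  horizon_gt0 : forall a, 0 < T 0 a;
  uvals_compact : compact (uvals G);
  uvals_neq0 : uvals G !=set0;
  vvals_compact : compact (vvals G);
  vvals_neq0 : vvals G !=set0;
  dyn_bounded : forall a, data_bounded (dyn G a);
  dyn_unif_continuous : forall a, data_unif_continuous (dyn G a);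
  dyn_lipschitz : forall a, data_lipschitz (dyn G a);
  cost_bounded : forall a, data_bounded (cost G a);
  cost_unif_continuous : forall a, data_unif_continuous (cost G a);
  cost_lipschitz : forall a, data_lipschitz (cost G a);
  terminal_bounded : exists C : R, forall x, `|terminal G x| <= C;
  terminal_lipschitz : exists K : R, forall x x',
    `|terminal G x - terminal G x'| <= K * `|x - x'|;
  game_m_flow : m_flow;
  game_path_independent : work_path_independent
}.

(* The solution of the Cauchy problem, unique on box t T under m_flow. *)
Definition state t x u v : time -> space :=
  xget (fun=> x) [set y | trajectory t x u v y].

(* The work is computed along the segment from t to T; under
   work_path_independent any other increasing curve gives the same value. *)
Definition payoff t x u v : R :=
  let y := state t x u v in
  line_integral (running_cost u v y) (segment t T) + terminal G (y T).

Definition ustrategy t : set (vctrl -> uctrl) :=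
  [set Phi | (forall v, V t v -> U t (Phi v)) /\
     forall v v' tau, V t v -> V t v' -> box t T tau ->
       eq_ctrl_on (box t tau) v v' ->
       eq_ctrl_on (box t tau) (Phi v) (Phi v')].

Definition vstrategy t : set (uctrl -> vctrl) :=
  [set Psi | (forall u, U t u -> V t (Psi u)) /\
     forall u u' tau, U t u -> U t u' -> box t T tau ->
       eq_ctrl_on (box t tau) u u' ->
       eq_ctrl_on (box t tau) (Psi u) (Psi u')].

(* In the following four definitions sup and inf are the real-valued ones; the
   standing assumptions make the sets involved nonempty and bounded. *)
Definition upper_value t x : R :=
  sup [set inf [set payoff t x (Phi v) v | v in V t] | Phi in ustrategy t].

Definition lower_value t x : R :=
  inf [set sup [set payoff t x u (Psi u) | u in U t] | Psi in vstrategy t].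

Definition upper_hamiltonian (a : 'I_m) t x (P : space) : R :=
  inf [set sup [set dot P (dyn G a t x b c) + cost G a t x b c
               | b in uvals G] | c in vvals G].

Definition lower_hamiltonian (a : 'I_m) t x (P : space) : R :=
  sup [set inf [set dot P (dyn G a t x b c) + cost G a t x b c
               | c in vvals G] | b in uvals G].

End Game.

Section Viscosity.
Context {R : realType} {m n : nat}.
Local Notation point := ('rV[R]_m * 'rV[R]_n)%type.

(* omega is C^1 on D with partial gradients dt and dx; differentiability is
   relative to D, so that boundary points of D are covered. *)
Definition C1_with_gradient (D : set point) (omega : point -> R)
    (dt : point -> 'rV[R]_m) (dx : point -> 'rV[R]_n) : Prop :=
  [/\ {within D, continuous dt},
      {within D, continuous dx}
    & forall z, D z -> forall e : R, 0 < e ->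
        \forall z' \near within D (nbhs z),
          `|omega z' - omega z
            - (dot (dt z) (z'.1 - z.1) + dot (dx z) (z'.2 - z.2))|
          <= e * `|z' - z|].

(* Viscosity solutions of dw/dt^a + H_a(t, x, dw/dx) = 0 for all a, with the
   sign convention of terminal value problems. *)
Definition viscosity_solution (T : 'rV[R]_m)
    (H : 'I_m -> 'rV[R]_m -> 'rV[R]_n -> 'rV[R]_n -> R)
    (w : 'rV[R]_m -> 'rV[R]_n -> R) : Prop :=
  let D : set point := [set z | box 0 T z.1] in
  forall omega dt dx, C1_with_gradient D omega dt dx ->
  forall (t : 'rV[R]_m) (x : 'rV[R]_n),
    box 0 T t -> (forall a, t 0 a < T 0 a) ->
    ((\forall z \near within D (nbhs (t, x)),
        w z.1 z.2 - omega z <= w t x - omega (t, x)) ->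
      forall a, 0 <= dt (t, x) 0 a + H a t x (dx (t, x)))
    /\
    ((\forall z \near within D (nbhs (t, x)),
        w t x - omega (t, x) <= w z.1 z.2 - omega z) ->
      forall a, dt (t, x) 0 a + H a t x (dx (t, x)) <= 0).

End Viscosity.

(* Main.v *)
Require Import Defs.
From mathcomp Require Import finmap all_boot all_order all_algebra.
From mathcomp Require Import all_classical all_reals all_analysis.
From mathcomp Require Import measurable_realfun ring lra.

(* The proof moves along one time axis at a time, from t to t' = t + h e_a, where
   everything reduces to the single-time argument of Evans and Souganidis.
   Controls can be concatenated across the hyperplane s_a = t'_a, states and
   payoffs have the flow property along concatenated curves, and a contraction
   argument shows that for h K <= 1/2 the state at t' only depends on the
   controls met before t' on the segment from t to t'.  This gives the two halves
   of dynamic programming for M: an almost optimal strategy at t, answering a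
   given control before t', restricts to a strategy at t'; conversely a strategy
   used before t' can be followed by a strategy at t' that is almost optimal for
   the state reached there.  If the subsolution inequality failed, the opponent
   would gain by a constant control that almost attains the outer minimum; if
   the supersolution inequality failed, the u-team would gain by answering v_a(s)
   with f(v_a(s)), where f is a finitely valued Borel selection of almost optimal
   replies, obtained from the compactness of the control set.  The statement on
   the lower value follows by exchanging the teams and changing the signs of the
   costs. *)

Set Implicit Arguments.
Unset Strict Implicit.
Unset Printing Implicit Defensive.

Import Order.TTheory GRing.Theory Num.Theory.
Import numFieldNormedType.Exports.

Local Open Scope classical_set_scope.
Local Open Scope ring_scope.

(** * Affine changes of variable *)

Section AffineChange.
Context {R : realType}.
Notation mu := (@lebesgue_measure R).
Variables (k c : R).
Hypothesis k_gt0 : 0 < k.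
Let phi : R -> R := fun r => k * r + c.

Let mphi : measurable_fun [set: R] phi.
Proof.
by apply: continuous_measurable_fun => r; apply: cvgD; [apply: cvgM|]; apply: cvg_cst || apply: cvg_id.
Qed.

Lemma preimage_affine_itv (b1 b2 : bool) (x y : R) :
  (fun r => k * r + c) @^-1` [set` Interval (BSide b1 x) (BSide b2 y)] =
  [set` Interval (BSide b1 ((x - c) / k)) (BSide b2 ((y - c) / k))].
Proof.
apply/seteqP; split => r /=; rewrite !itv_boundlr /= => /andP[];
  case: b1; case: b2; rewrite !bnd_simp => h1 h2; apply/andP; split;
  rewrite ?bnd_simp; move: h1 h2;
  rewrite ?ler_pdivrMr ?ltr_pdivrMr ?ler_pdivlMr ?ltr_pdivlMr //; nra.
Qed.

(** The map [phi] retyped over the measurable type that carries [mu], so that the push-forward of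
    [mu] is well typed. *)
Let psi : measurableTypeR R -> measurableTypeR R := phi.

(** By uniqueness of Lebesgue measure: [k] times the push-forward of [mu] under the affine map gives
    each half-open interval its length. *)
Let lebesgue_affine (A : set R) : measurable A ->
  mu A = (k%:E * mu (phi @^-1` A))%E.
Proof.
pose k0 : {nonneg R} := NngNum (ltW k_gt0).
move=> mA; apply: (@lebesgue_measure_unique R
  (mscale k0 (pushforward mu psi)) _ A mA) => //= _ [[a b] _ <-] /=.
rewrite /mscale /= /pushforward preimage_affine_itv.
rewrite [LHS]lebesgue_measure_itv [X in (_ * X)%E]lebesgue_measure_itv /=.
rewrite !lte_fin ltr_pM2r ?invr_gt0// ltrD2r; case: ifP => _.
  by rewrite -!EFinB -EFinM; congr EFin; field; rewrite gt_eqF.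
by rewrite mule0.
Qed.

Let ge0_integral_affine (D : set R) (f : R -> \bar R) : measurable D ->
  measurable_fun D f -> (forall r, D r -> 0 <= f r)%E ->
  (\int[mu]_(r in D) f r = k%:E * \int[mu]_(r in phi @^-1` D) f (phi r))%E.
Proof.
move=> mD mf f0.
pose k0 : {nonneg R} := NngNum (ltW k_gt0).
rewrite (@eq_measure_integral _ _ _ _ (mscale k0 (pushforward mu psi))).
  rewrite ge0_integral_mscale// ge0_integral_pushforward//.
by move=> r; rewrite inE; exact: f0.
by move=> A mA _; exact: lebesgue_affine.
Qed.

Lemma integrable_affine (D : set R) (f : R -> R) : measurable D ->
  mu.-integrable D (EFin \o f) ->
  mu.-integrable ((fun r => k * r + c) @^-1` D)
    (EFin \o (fun r => f (k * r + c))).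
Proof.
move=> mD /integrableP[mf fi]; apply/integrableP; split.
  apply: (@measurable_comp _ _ _ _ _ _ D (EFin \o f) _ phi) => //.
    by move=> _ [r Dr <-].
  exact: measurable_funTS.
move: fi; rewrite ge0_integral_affine//; last exact: measurableT_comp.
set I := (X in (_ * X)%E) => kI; change (I < +oo)%E.
have I0 : (0 <= I)%E by exact: integral_ge0.
move: kI I0; case: I => [r _ _||] //; first by rewrite ltry.
by rewrite gt0_muley ?lte_fin.
Qed.

Lemma Rintegral_affine (D : set R) (f : R -> R) : measurable D ->
  mu.-integrable D (EFin \o f) ->
  \int[mu]_(r in D) f r =
  k * \int[mu]_(r in (fun r => k * r + c) @^-1` D) f (k * r + c).
Proof.
move=> mD fi; have mf := measurable_int mu fi.
have fi' : mu.-integrable (phi @^-1` D) ((EFin \o f) \o phi).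
  exact: integrable_affine.
have mD' : @measurable _ (measurableTypeR R) (phi @^-1` D).
  by rewrite -[X in measurable X]setTI; exact: mphi.
have mfp := measurable_funepos mf.
have mfn := measurable_funeneg mf.
rewrite /Rintegral [in LHS]integralE ge0_integral_affine//.
rewrite [X in (_ - X)%E]ge0_integral_affine//.
have := integrable_fin_num mD' (integrable_funepos mD' fi').
have := integrable_fin_num mD' (integrable_funeneg mD' fi').
rewrite funepos_comp funeneg_comp => fn fp.
(* Both parts have finite integrals, so [k] factors out of their difference in the extended
   reals. *)
rewrite -muleBr//; last by rewrite fin_num_adde_defl// fin_numN; exact: fn.
rewrite -[k in RHS]/(fine k%:E) -fineM//; last exact: integrable_fin_num fi'.
by rewrite [in RHS]integralE (funepos_comp (EFin \o f) phi)
  (funeneg_comp (EFin \o f) phi).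
Qed.

End AffineChange.
Arguments integrable_affine {R k} c k_gt0 {D f} mD _.
Arguments Rintegral_affine {R k} c k_gt0 {D f} mD _.

(** * Continuity, derivatives and integrals under affine reparametrization *)

Section AffineReparametrization.
Context {R : realType}.
Notation mu := (@lebesgue_measure R).
Implicit Types (f g : R -> R).

Lemma continuous_affine (k c : R) : continuous (fun r : R => k * r + c).
Proof.
move=> r; apply: cvgD; last exact: cvg_cst.
by apply: cvgM; [exact: cvg_cst|exact: cvg_id].
Qed.

Lemma is_derive_affine (k c r : R) : is_derive r 1 (fun r : R => k * r + c) k.
Proof. by apply: is_derive_eq; rewrite addr0 -[RHS]mulr1. Qed.

Lemma within_continuous_affine (a b k c : R) f g : 0 < k ->
  {within `[k * a + c, k * b + c], continuous f} ->
  (forall r, a <= r <= b -> g r = f (k * r + c)) ->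
  {within `[a, b], continuous g}.
Proof.
move=> k_gt0 /subspace_continuousP fc gf; apply/subspace_continuousP => x xab.
have phiab r : `[a, b]%classic r -> `[k * a + c, k * b + c]%classic (k * r + c).
  by rewrite /= !in_itv /= !lerD2r !ler_pM2l.
rewrite /from_subspace in fc *.
rewrite gf//.
apply: (@cvg_trans _ ((fun r => f (k * r + c)) @ within `[a, b] (nbhs x))).
  apply: near_eq_cvg; rewrite near_withinE; apply: nearW => r rab.
  by rewrite gf.
apply: (@cvg_comp _ _ _ (fun r => k * r + c) f); last exact: fc (phiab _ xab).
move=> W; rewrite /= !near_simpl /within /= => nW.
have := @continuous_affine k c x _ nW.
rewrite /= !near_simpl; apply: filterS => r /= h rab; exact: h (phiab _ rab).
Qed.

(* No derivability is assumed: where f is not derivable, both sides are 0, the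
   default value of limits. *)
Lemma derive1_affine f (k c r : R) : k != 0 ->
  derive1 (fun r => f (k * r + c)) r = k * derive1 f (k * r + c).
Proof.
move=> k0.
have [df|ndf] := pselect (derivable f (k * r + c) 1).
  have [_] := @is_derive1_comp R f (fun r => k * r + c) r _ _
    (derivableP df) (is_derive_affine k c r).
  by rewrite !derive1E mulrC.
have ndg : ~ derivable (fun r => f (k * r + c)) r 1.
  move=> dg; apply: ndf.
  have {}dg : derivable (fun r => f (k * r + c)) (k^-1 * (k * r + c) - k^-1 * c) 1.
    by rewrite mulrDr addrK mulKf.
  have [+ _] := @is_derive1_comp R _ (fun r => k^-1 * r + - (k^-1 * c))
    (k * r + c) _ _ (derivableP dg) (is_derive_affine _ _ _).
  rewrite (_ : _ \o _ = f)//; apply/funext => s /=.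
  by rewrite mulrDr mulrN !mulVKf// subrK.
by rewrite !derive1E /derive (dvgP ndf) (dvgP ndg) mulr0.
Qed.

Lemma integrable_oo_cc f (a b : R) :
  mu.-integrable `]a, b[ (EFin \o f) -> mu.-integrable `[a, b] (EFin \o f).
Proof.
move=> /integrableP[mf fi]; apply/integrableP; split.
  exact: emeasurable_fun_itv_cc mf.
by rewrite integral_itv_bndoo//; exact: measurableT_comp.
Qed.

Lemma Rintegral_oo_cc f (a b : R) :
  mu.-integrable `]a, b[ (EFin \o f) ->
  \int[mu]_(r in `[a, b]) f r = \int[mu]_(r in `]a, b[) f r.
Proof.
by move=> /integrableP[mf _]; rewrite /Rintegral integral_itv_bndoo.
Qed.

(** The relation between [f] and [g] is asked on the open interval only, since the derivative of a
    concatenated curve is not controlled at the junction; end points have measure zero. *)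
Lemma Rintegral_affine_itv f g (a b k c : R) : 0 < k ->
  (forall r, a < r < b -> g r = k * f (k * r + c)) ->
  mu.-integrable `[a, b] (EFin \o g) ->
  mu.-integrable `[k * a + c, k * b + c] (EFin \o f) /\
  \int[mu]_(r in `[k * a + c, k * b + c]) f r = \int[mu]_(r in `[a, b]) g r.
Proof.
move=> k_gt0 gf gi.
have k0 : k != 0 by rewrite gt_eqF.
have kV_gt0 : 0 < k^-1 by rewrite invr_gt0.
have preim r : (k * r + c - c) / k = r by rewrite addrK mulrC mulKf.
have {}gi : mu.-integrable `]a, b[ (EFin \o g).
  by apply: integrableS gi => // r /=; rewrite !in_itv /= => /andP[/ltW-> /ltW->].
have fki : mu.-integrable `]a, b[ (EFin \o (fun r => f (k * r + c))).
  have : mu.-integrable `]a, b[ (fun r => (k^-1)%:E * (EFin \o g) r)%E.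
    exact: integrableZl.
  apply: eq_integrable => // r; rewrite inE /= in_itv /= => rab.
  by rewrite gf// -EFinM mulKf.
have fi : mu.-integrable `]k * a + c, k * b + c[ (EFin \o f).
  (* Integrability is known for [g] and wanted for [f], hence the inverse substitution. *)
  have := integrable_affine (- (k^-1 * c)) kV_gt0 (measurable_itv `]a, b[) fki.
  rewrite preimage_affine_itv// !invrK !opprK ![(_ + k^-1 * c) * k]mulrDl.
  rewrite mulrAC mulVf// mul1r ![_ * k]mulrC.
  apply: eq_integrable => // r _ /=.
  by rewrite mulrDr mulrN !mulVKf// subrK.
split; first exact: integrable_oo_cc.
rewrite !Rintegral_oo_cc// (Rintegral_affine c k_gt0 _ fi)//.
rewrite preimage_affine_itv// !preim -RintegralZl//.
by apply: eq_Rintegral => r; rewrite inE /= in_itv /= => /gf ->.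
Qed.

End AffineReparametrization.

(** * Line integrals along concatenated curves and segments *)

Section Curves.
Context {R : realType} {m : nat}.
Implicit Types (t s tau : 'rV[R]_m) (gamma : R -> 'rV[R]_m).
Implicit Types (F : 'I_m -> 'rV[R]_m -> R).

(** Agreement on the closed interval suffices, which suits a concatenated curve: each half follows
    an affine reparametrization there but not beyond. *)
Lemma C1_on_affine (a b k c : R) (f g : R -> R) : 0 < k ->
  C1_on (k * a + c) (k * b + c) f ->
  (forall r, a <= r <= b -> g r = f (k * r + c)) ->
  C1_on a b g.
Proof.
move=> k_gt0 [fc [df dfc fd]] gf; split; first exact: within_continuous_affine gf.
exists (fun r => k * df (k * r + c)).
  have cdf : {within `[a, b], continuous (fun r => df (k * r + c))}.
    exact: within_continuous_affine dfc _.
  by move=> x; apply: cvgM; [exact: cvg_cst|exact: cdf].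
move=> r /andP[ar rb].
have fr : is_derive (k * r + c) 1 f (df (k * r + c)).
  by apply: fd; rewrite !ltrD2r !ltr_pM2l// ar.
apply: near_eq_is_derive; last first.
  rewrite mulrC.
  exact: (@is_derive1_comp R f (fun r => k * r + c) r _ _ fr
    (is_derive_affine k c r)).
near=> s; rewrite gf//; apply/andP; split; apply: ltW; near: s.
  exact: lt_nbhsr.
exact: lt_nbhsl.
Unshelve. all: by end_near. Qed.

(** The [+ 0] makes both halves instances of [k * r + c]. *)
Definition concat_curve gamma1 gamma2 : R -> 'rV[R]_m :=
  fun r => if r <= 2^-1 then gamma1 (2 * r + 0) else gamma2 (2 * r - 1).

Lemma increasing_curve_concat t s tau gamma1 gamma2 :
  increasing_curve t s gamma1 -> increasing_curve s tau gamma2 ->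
  increasing_curve t tau (concat_curve gamma1 gamma2).
Proof.
move=> [g10 g11 g1inc [br1 [br1p /eqP br1l] g1C]].
move=> [g20 g21 g2inc [br2 [br2p /eqP br2l] g2C]].
have half : (2 : R) * 2^-1 = 1 by rewrite divff.
split.
- by rewrite /concat_curve ifT ?mulr0 ?addr0// invr_ge0.
- rewrite /concat_curve ifF; last by apply/negbTE; rewrite -ltNge; lra.
  by rewrite -g21; congr gamma2; lra.
- move=> a r r' r0 rr' r'1; rewrite /concat_curve.
  case: (leP r 2^-1) => hr; case: (leP r' 2^-1) => hr'.
  + by apply: g1inc; lra.
  + apply: (@le_trans _ _ (s 0 a)).
      by rewrite -[X in _ <= X]/(s 0 a) -g11; apply: g1inc; lra.
    by rewrite -g20; apply: g2inc; lra.
  + by have := lt_le_trans hr (le_trans rr' hr'); rewrite ltxx.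
  + by apply: g2inc; lra.
(* [h1] and [h2] invert [2 * r + 0] and [2 * r - 1]; they carry the subdivisions of the two curves
   to the two halves of the unit interval. *)
pose h1 r : R := r / 2; pose h2 r : R := (r + 1) / 2.
have map_path_lt (h : R -> R) x l : {mono h : x y / x < y} ->
    path <%O x l -> path <%O (h x) [seq h r | r <- l].
  move=> hh; elim: l x => //= y l ih x /andP[xy /ih ->].
  by rewrite hh xy.
have h10 : h1 0 = 0 by rewrite /h1 mul0r.
have h11 : h1 1 = h2 0 by rewrite /h1 /h2 add0r.
have h21 : h2 1 = 1 by rewrite /h2; lra.
exists ([seq h1 r | r <- br1] ++ [seq h2 r | r <- br2]).
  apply: (@itv_partition_cat _ _ _ (h1 1)); split.
  - by rewrite -h10; apply: map_path_lt br1p => x y; rewrite ltr_pM2r ?invr_gt0.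
  - by rewrite -{1}h10 last_map br1l.
  - rewrite h11; apply: map_path_lt br2p => x y.
    by rewrite ltr_pM2r ?invr_gt0// ltrD2r.
  - by rewrite h11 last_map br2l h21.
move=> a k klt.
have hsz : size [seq h1 r | r <- br1] = size br1 by rewrite size_map.
case: (ltnP k (size br1)) => kbr.
  have -> : nth 0 (0 :: ([seq h1 r | r <- br1] ++ [seq h2 r | r <- br2])) k
      = h1 (nth 0 (0 :: br1) k).
    rewrite -cat_cons nth_cat /= hsz ltnW ?ltnS//.
    by rewrite -{2}h10 -map_cons (nth_map 0)//= ltnS ltnW.
  have -> : nth 0 ([seq h1 r | r <- br1] ++ [seq h2 r | r <- br2]) k
      = h1 (nth 0 br1 k).
    by rewrite nth_cat hsz kbr (nth_map 0).
  have y1 : nth 0 br1 k <= 1.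
    rewrite (set_nth_default 1)//.
    by apply: (@itv_partition_nth_le _ _ _ _ _ k.+1 _ (conj br1p (introT eqP br1l))).
  apply: (@C1_on_affine _ _ 2 0 (fun r => gamma1 r 0 a)) => //.
    by rewrite /h1 !addr0 ![2 * (_ / 2)]mulrC !divfK//; exact: g1C.
  move=> r /andP[_ ry]; rewrite /concat_curve ifT//.
  by apply: (le_trans ry); rewrite /h1; lra.
pose j := (k - size br1)%N.
have jlt : (j < size br2)%N.
  by move: klt; rewrite size_cat !size_map -{1}(subnKC kbr) ltn_add2l.
have -> : nth 0 (0 :: ([seq h1 r | r <- br1] ++ [seq h2 r | r <- br2])) k
    = h2 (nth 0 (0 :: br2) j).
  (* The last point [h1 1] of the first subdivision is also [h2 0], the left end of the second one,
     so it is moved to the head of the second list. *)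
  rewrite -cat_cons lastI cat_rcons nth_cat size_belast hsz ltnNge kbr /=.
  by rewrite -{2}h10 last_map br1l h11 -map_cons (nth_map 0)//= ltnS ltnW.
have -> : nth 0 ([seq h1 r | r <- br1] ++ [seq h2 r | r <- br2]) k
    = h2 (nth 0 br2 j).
  by rewrite nth_cat hsz ltnNge kbr /= (nth_map 0).
have x0 : 0 <= nth 0 (0 :: br2) j.
  rewrite (set_nth_default 1)/=; last by rewrite ltnS ltnW.
  apply: (itv_partition_nth_ge _ (conj br2p (introT eqP br2l))).
  by rewrite ltnS ltnW.
apply: (@C1_on_affine _ _ 2 (- 1) (fun r => gamma2 r 0 a)) => //.
  have e (z : R) : 2 * h2 z - 1 = z by rewrite /h2; lra.
  by rewrite !e; exact: g2C.
move=> r /andP[xr _]; rewrite /concat_curve.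
have r2 : 2^-1 <= r by apply: le_trans xr; rewrite /h2; lra.
(* At [2^-1] the first branch is taken; both curves pass through [s] there. *)
case: ltgtP r2 => // <- _.
rewrite addr0 half subrr g11 g20//.
Qed.

(** The strict bounds make the concatenated curve coincide with its first half near [r], so the
    derivatives agree. *)
Lemma line_integrand_concat1 F gamma1 gamma2 a r : 0 < r < 2^-1 ->
  line_integrand F (concat_curve gamma1 gamma2) a r =
  2 * line_integrand F gamma1 a (2 * r + 0).
Proof.
move=> /andP[r0 r1]; rewrite /line_integrand {1}/concat_curve (ltW r1).
rewrite [RHS]mulrCA -derive1_affine// !derive1E; congr (_ * _).
apply: near_eq_derive; near=> s; rewrite /concat_curve ifT//.
by apply: ltW; near: s; exact: lt_nbhsl.
Unshelve. all: by end_near. Qed.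

Lemma line_integrand_concat2 F gamma1 gamma2 a r : 2^-1 < r < 1 ->
  line_integrand F (concat_curve gamma1 gamma2) a r =
  2 * line_integrand F gamma2 a (2 * r - 1).
Proof.
move=> /andP[r0 r1]; rewrite /line_integrand {1}/concat_curve leNgt r0 /=.
rewrite [RHS]mulrCA -derive1_affine// !derive1E; congr (_ * _).
apply: near_eq_derive; near=> s; rewrite /concat_curve leNgt ifF//.
by apply/negbF; near: s; exact: lt_nbhsr.
Unshelve. all: by end_near. Qed.

(** Integrability descends from the whole curve to its halves: the standing assumptions provide it
    along whole curves, and the flow property needs it on the pieces. *)
Lemma line_integral_concat F gamma1 gamma2 :
  line_integrable F (concat_curve gamma1 gamma2) ->
  [/\ line_integrable F gamma1, line_integrable F gamma2 &
    line_integral F (concat_curve gamma1 gamma2) =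
    line_integral F gamma1 + line_integral F gamma2].
Proof.
move=> Fi.
have Fi1 a : (@lebesgue_measure R).-integrable `[0, 2^-1]
    (EFin \o line_integrand F (concat_curve gamma1 gamma2) a).
  apply: integrableS (Fi a) => // r; rewrite /= !in_itv /= => /andP[-> /= h].
  by lra.
have Fi2 a : (@lebesgue_measure R).-integrable `[2^-1, 1]
    (EFin \o line_integrand F (concat_curve gamma1 gamma2) a).
  apply: integrableS (Fi a) => // r; rewrite /= !in_itv /= => /andP[h ->].
  by rewrite andbT; lra.
have two_gt0 : 0 < 2 :> R by [].
have e1 : 2 * 0 + 0 = 0 :> R by lra.
have e2 : 2 * 2^-1 + 0 = 1 :> R by lra.
have e3 : 2 * 2^-1 - 1 = 0 :> R by lra.
have e4 : 2 * 1 - 1 = 1 :> R by lra.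
have I1 a := Rintegral_affine_itv two_gt0
  (@line_integrand_concat1 F gamma1 gamma2 a) (Fi1 a).
have I2 a := Rintegral_affine_itv two_gt0
  (@line_integrand_concat2 F gamma1 gamma2 a) (Fi2 a).
rewrite e1 e2 in I1; rewrite e3 e4 in I2.
split; [by move=> a; case: (I1 a)|by move=> a; case: (I2 a)|].
rewrite /line_integral -big_split; apply: eq_bigr => a _ /=.
rewrite (I1 a).2 (I2 a).2.
have Fi2' : (@lebesgue_measure R).-integrable `]2^-1, 1]
    (EFin \o line_integrand F (concat_curve gamma1 gamma2) a).
  by apply: integrableS (Fi2 a) => // r; rewrite /= !in_itv /= => /andP[/ltW -> ->].
rewrite -(Rintegral_itv_obnd_cbnd Fi2').
have := @Rintegral_itvB R _ _ _ 2^-1 (Fi a).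
rewrite !bnd_simp => <-; [|lra|lra].
by rewrite addrC subrK.
Qed.

Lemma segment_coord t tau r a : segment t tau r 0 a = (tau - t) 0 a * r + t 0 a.
Proof. by rewrite /segment mxE [X in _ + X]mxE mulrC addrC. Qed.

Lemma increasing_segment t tau : (forall a, t 0 a <= tau 0 a) ->
  increasing_curve t tau (segment t tau).
Proof.
move=> ttau; split.
- by rewrite /segment scale0r addr0.
- by rewrite /segment scale1r addrC subrK.
- move=> a r r' _ rr' _; rewrite !segment_coord lerD2r ler_wpM2l//.
  by rewrite !mxE subr_ge0.
exists [:: 1]; first by apply: itv_partition1; exact: ltr01.
move=> a [|//] _ /=; split.
  apply: continuous_subspaceT.
  under eq_fun do rewrite segment_coord; exact: continuous_affine.
exists (fun=> (tau - t) 0 a).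
  by apply: continuous_subspaceT; exact: cst_continuous.
move=> r _; under eq_fun do rewrite segment_coord; exact: is_derive_affine.
Qed.

Lemma line_integrand_segment F t tau a r :
  line_integrand F (segment t tau) a r =
  F a (segment t tau r) * (tau - t) 0 a.
Proof.
rewrite /line_integrand; congr (_ * _).
under eq_fun do rewrite segment_coord.
by rewrite derive1E; have [_ ->] := is_derive_affine ((tau - t) 0 a) (t 0 a) r.
Qed.

Lemma line_integrand_eq F F' gamma a r : F a (gamma r) = F' a (gamma r) ->
  line_integrand F gamma a r = line_integrand F' gamma a r.
Proof. by rewrite /line_integrand => ->. Qed.

Lemma line_integrable_eq F F' gamma :
  (forall a r, 0 <= r <= 1 -> F a (gamma r) = F' a (gamma r)) ->
  line_integrable F gamma -> line_integrable F' gamma.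
Proof.
move=> FF' Fi a; apply: eq_integrable (Fi a) => // r; rewrite inE /= in_itv /= => r01.
by rewrite (line_integrand_eq (FF' a r r01)).
Qed.

Lemma line_integral_eq F F' gamma :
  (forall a r, 0 <= r <= 1 -> F a (gamma r) = F' a (gamma r)) ->
  line_integral F gamma = line_integral F' gamma.
Proof.
move=> FF'; apply: eq_bigr => a _; apply: eq_Rintegral => r.
by rewrite inE /= in_itv /= => r01; rewrite (line_integrand_eq (FF' a r r01)).
Qed.

Lemma increasing_curve_box t tau gamma r : increasing_curve t tau gamma ->
  0 <= r <= 1 -> box t tau (gamma r).
Proof.
move=> [<- <- ginc _] /andP[r0 r1] a.
by rewrite !ginc.
Qed.

End Curves.

(** * Linearity and estimates of line integrals, and segments along one axis *)

Section LineIntegral.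
Context {R : realType} {m : nat}.
Notation mu := (@lebesgue_measure R).
Implicit Types (t s tau : 'rV[R]_m) (gamma : R -> 'rV[R]_m).
Implicit Types (F : 'I_m -> 'rV[R]_m -> R).

Lemma line_integralD F F' gamma :
  line_integrable F gamma -> line_integrable F' gamma ->
  line_integrable (fun a s => F a s + F' a s) gamma /\
  line_integral (fun a s => F a s + F' a s) gamma =
  line_integral F gamma + line_integral F' gamma.
Proof.
have E a r : line_integrand (fun a s => F a s + F' a s) gamma a r =
    line_integrand F gamma a r + line_integrand F' gamma a r.
  by rewrite /line_integrand mulrDl.
move=> Fi F'i; split.
  move=> a.
  have : mu.-integrable `[0, 1] ((EFin \o line_integrand F gamma a) \+
      (EFin \o line_integrand F' gamma a))%E.
    exact: integrableD.
  by apply: eq_integrable => // r _; rewrite /= E EFinD.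
rewrite /line_integral -big_split; apply: eq_bigr => a _ /=.
rewrite -RintegralD//.
by apply: eq_Rintegral => r _; rewrite E.
Qed.

Lemma line_integralZ F gamma (k : R) : line_integrable F gamma ->
  line_integrable (fun a s => k * F a s) gamma /\
  line_integral (fun a s => k * F a s) gamma = k * line_integral F gamma.
Proof.
have E a r : line_integrand (fun a s => k * F a s) gamma a r =
    k * line_integrand F gamma a r by rewrite /line_integrand mulrA.
move=> Fi; split.
  move=> a.
  have : mu.-integrable `[0, 1]
      (fun r => k%:E * (EFin \o line_integrand F gamma a) r)%E.
    exact: integrableZl.
  by apply: eq_integrable => // r _; rewrite /= E EFinM.
rewrite /line_integral big_distrr; apply: eq_bigr => a _ /=.
rewrite -RintegralZl//.
by apply: eq_Rintegral => r _; rewrite E.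
Qed.

Lemma line_integral0 gamma :
  line_integrable (fun _ _ => 0) gamma /\ line_integral (fun _ _ => 0) gamma = 0.
Proof.
have E a r : line_integrand (fun _ _ => 0) gamma a r = 0.
  by rewrite /line_integrand mul0r.
split.
  move=> a; apply: (eq_integrable _ (cst 0%E)) => //; last exact: integrable0.
  by move=> r _; rewrite /= E.
rewrite /line_integral big1// => a _.
by under eq_Rintegral do rewrite E; rewrite Rintegral_cst// mul0r.
Qed.

Lemma line_integral_dot {k : nat} (P : 'rV[R]_k) (X : 'I_m -> 'rV[R]_m -> 'rV[R]_k)
    gamma :
  (forall i, line_integrable (fun a s => X a s 0 i) gamma) ->
  line_integrable (fun a s => dot P (X a s)) gamma /\
  line_integral (fun a s => dot P (X a s)) gamma =
  \sum_i P 0 i * line_integral (fun a s => X a s 0 i) gamma.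
Proof.
move=> Xi; rewrite /dot; elim: (index_enum _) => [|i r [ih1 ih2]].
  rewrite big_nil.
  under eq_fun do under eq_fun do rewrite big_nil.
  exact: line_integral0.
rewrite big_cons -ih2.
under eq_fun do under eq_fun do rewrite big_cons.
have [Zi Ze] := line_integralZ (P 0 i) (Xi i).
by rewrite -Ze; exact: line_integralD.
Qed.

Lemma integrable_cst01 (k : R) : mu.-integrable `[0, 1] (cst k%:E).
Proof.
apply/integrableP; split; first exact: measurable_cst.
by rewrite /= integral_cst//= lebesgue_measure_itv /= lte01 oppr0 adde0 mule1 ltry.
Qed.

Lemma line_integral_segment_bound F t tau (C : R) :
  (forall a, t 0 a <= tau 0 a) ->
  line_integrable F (segment t tau) ->
  (forall a s, box t tau s -> `|F a s| <= C) ->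
  `|line_integral F (segment t tau)| <= \sum_a C * (tau 0 a - t 0 a).
Proof.
move=> ttau Fi FC; apply: le_trans (ler_norm_sum _ _ _) _.
apply: ler_sum => a _; apply: le_trans (le_normr_Rintegral _ (Fi a)) _ => //.
have -> : C * (tau 0 a - t 0 a) =
    \int[mu]_(r in `[0, 1]) (C * (tau 0 a - t 0 a)).
  by rewrite Rintegral_cst//= lebesgue_measure_itv /= lte01 oppr0 adde0 mulr1.
apply: le_Rintegral => //.
- exact: integrable_norm (Fi a).
- exact: integrable_cst01.
- move=> r; rewrite /= in_itv /= => r01; rewrite line_integrand_segment normrM.
  rewrite !mxE [ `|tau 0 a - t 0 a|]ger0_norm ?subr_ge0// ler_wpM2r ?subr_ge0//.
  exact/FC/(increasing_curve_box (increasing_segment ttau)).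
Qed.

Definition axis_step t (a : 'I_m) (h : R) := t + h *: delta_mx 0 a.

Lemma axis_step_coord t a h b :
  axis_step t a h 0 b = t 0 b + (if b == a then h else 0).
Proof. by rewrite !mxE eqxx /=; case: eqP; rewrite ?mulr1 ?mulr0. Qed.

Lemma segment_axis t a h r : segment t (axis_step t a h) r = axis_step t a (r * h).
Proof. by rewrite /segment /axis_step [t + _ - t]addrAC subrr add0r scalerA. Qed.

Lemma axis_stepB t a h : axis_step t a h - t = h *: delta_mx 0 a.
Proof. by rewrite /axis_step addrAC subrr add0r. Qed.

(** The other components of the segment are constant. This isolates the equation of index [a] from
    the system. *)
Lemma line_integral_axis F t a h :
  line_integral F (segment t (axis_step t a h)) =
  \int[mu]_(r in `[0, 1]) line_integrand F (segment t (axis_step t a h)) a r.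
Proof.
rewrite /line_integral (bigD1 a)//= big1 ?addr0// => b /negbTE ba.
under eq_Rintegral do rewrite line_integrand_segment !mxE eqxx ba mulr0 addr0 subrr mulr0.
by rewrite Rintegral_cst// mul0r.
Qed.

Lemma line_integrand_axis F t a h r :
  line_integrand F (segment t (axis_step t a h)) a r = F a (axis_step t a (r * h)) * h.
Proof.
by rewrite line_integrand_segment axis_stepB !mxE !eqxx /= mulr1 segment_axis.
Qed.

Lemma line_integrable_axis_oo F t a h :
  line_integrable F (segment t (axis_step t a h)) ->
  mu.-integrable `]0, 1[
    (EFin \o line_integrand F (segment t (axis_step t a h)) a).
Proof.
move=> Fi; apply: integrableS (Fi a) => // r.
by rewrite /= !in_itv /= => /andP[/ltW-> /ltW->].
Qed.

(** End points have measure zero, so the values of a concatenated control on the face where the step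
    ends do not enter. *)
Lemma line_integral_axis_le F F' t a h : 0 <= h ->
  line_integrable F (segment t (axis_step t a h)) ->
  line_integrable F' (segment t (axis_step t a h)) ->
  (forall r, 0 < r < 1 ->
    F a (axis_step t a (r * h)) <= F' a (axis_step t a (r * h))) ->
  line_integral F (segment t (axis_step t a h)) <=
  line_integral F' (segment t (axis_step t a h)).
Proof.
move=> h0 /line_integrable_axis_oo Fi /line_integrable_axis_oo F'i FF'.
rewrite !line_integral_axis !Rintegral_oo_cc//.
apply: le_Rintegral => // r; rewrite /= in_itv /= => r01.
by rewrite !line_integrand_axis ler_wpM2r// FF'.
Qed.

Lemma line_integral_axis_cst t a h (k : R) :
  line_integrable (fun _ _ => k) (segment t (axis_step t a h)) /\
  line_integral (fun _ _ => k) (segment t (axis_step t a h)) = h * k.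
Proof.
split.
  move=> b; apply: (eq_integrable _ (cst (k * (axis_step t a h - t) 0 b)%:E)) => //.
    by move=> r _; rewrite /= line_integrand_segment.
  exact: integrable_cst01.
rewrite line_integral_axis.
under eq_Rintegral do rewrite line_integrand_axis.
by rewrite Rintegral_cst//= lebesgue_measure_itv /= lte01 oppr0 adde0 mulr1 mulrC.
Qed.

End LineIntegral.

(** * Sup norm and dot product *)

Section RowVectors.
Context {R : realType} {k : nat}.
Implicit Types x y : 'rV[R]_k.

Lemma coord_le_norm x i : `|x 0 i| <= `|x|.
Proof.
rewrite [leRHS]/Num.Def.normr/= mx_normrE.
exact: (le_bigmax _ (fun ij => `|x ij.1 ij.2|) (0, i)).
Qed.

Lemma norm_le_coord x (c : R) : 0 <= c -> (forall i, `|x 0 i| <= c) -> `|x| <= c.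
Proof.
move=> c0 xc; rewrite [leLHS]/Num.Def.normr/= mx_normrE.
by rewrite (bigmax_le _ c0)//= => -[i j] _ /=; rewrite ord1.
Qed.

Lemma dotBr x y y' : dot x (y - y') = dot x y - dot x y'.
Proof.
by rewrite /dot -sumrB; apply: eq_bigr => i _; rewrite !mxE mulrBr.
Qed.

(** The norm of row vectors is the sup norm, whence the factor [k]. *)
Lemma norm_dot_le x y : `|dot x y| <= k%:R * `|x| * `|y|.
Proof.
apply: le_trans (ler_norm_sum _ _ _) _.
have -> : k%:R * `|x| * `|y| = \sum_(i < k) `|x| * `|y|.
  by rewrite sumr_const card_ord -mulrA mulr_natl.
by apply: ler_sum => i _; rewrite normrM ler_pM// coord_le_norm.
Qed.

End RowVectors.

(** * Borel controls *)

Section Boxes.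
Context {R : realType} {m : nat} {T : 'rV[R]_m}.
Implicit Types (t tau s : 'rV[R]_m) (a : 'I_m).

Lemma box_le t tau s : box t tau s -> forall a, t 0 a <= s 0 a.
Proof. by move=> b a; case/andP: (b a). Qed.

Lemma box_ge t tau s : box t tau s -> forall a, s 0 a <= tau 0 a.
Proof. by move=> b a; case/andP: (b a). Qed.

Lemma box_refl t tau : (forall a, t 0 a <= tau 0 a) -> box t tau t.
Proof. by move=> h a; rewrite lexx h. Qed.

Lemma box_end t tau : (forall a, t 0 a <= tau 0 a) -> box t tau tau.
Proof. by move=> h a; rewrite lexx h. Qed.

Lemma box_trans t tau s : box 0 T t -> box t T tau -> box tau T s -> box t T s.
Proof.
by move=> bt btau bs a; rewrite (le_trans (box_le btau a) (box_le bs a)) (box_ge bs).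
Qed.

Lemma box_trans_left t tau s : box t T tau -> box t tau s -> box t T s.
Proof.
by move=> btau bs a; rewrite (box_le bs) (le_trans (box_ge bs a) (box_ge btau a)).
Qed.

Lemma box0_trans t s : box 0 T t -> box t T s -> box 0 T s.
Proof.
by move=> bt bs a; rewrite (le_trans (box_le bt a) (box_le bs a)) (box_ge bs).
Qed.

Lemma borel_funS (k l : nat) (D E : set 'rV[R]_k) (f : 'rV[R]_k -> 'rV[R]_l) :
  @measurable _ (g_sigma_algebraType (@open 'rV[R]_k)) E ->
  D `<=` E -> borel_fun E f ->
  borel_fun D f.
Proof. by move=> mE DE; exact: measurable_funS. Qed.

Lemma closed_box t tau : closed (box t tau).
Proof.
rewrite (_ : box t tau =
  \bigcap_(a in [set: 'I_m]) ((fun s : 'rV[R]_m => s 0 a) @^-1` `[t 0 a, tau 0 a])).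
  apply: closed_bigI => a _; apply: closed_comp; last exact: itv_closed.
  by move=> s _; exact: coord_continuous.
apply/seteqP; split => [s bs a _ | s bs a]; first by rewrite /= in_itv /=; exact: bs.
by have := bs a I; rewrite /= in_itv.
Qed.

Lemma borel_open (k : nat) (A : set 'rV[R]_k) : open A ->
  @measurable _ (g_sigma_algebraType (@open 'rV[R]_k)) A.
Proof. exact: sub_sigma_algebra. Qed.

Lemma borel_closed (k : nat) (A : set 'rV[R]_k) : closed A ->
  @measurable _ (g_sigma_algebraType (@open 'rV[R]_k)) A.
Proof.
by move=> cA; rewrite -(setCK A); apply: measurableC; apply: borel_open; exact: closed_openC.
Qed.

(** Common form of [U] and [V], to which both unfold, so that restriction and concatenation are
    proved once for the two teams. *)
Definition controls k (W : set 'rV[R]_k) t : set ('I_m -> 'rV[R]_m -> 'rV[R]_k) :=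
  [set w | forall a, borel_fun (box t T) (w a) /\ forall s, box t T s -> W (w a s)].

Lemma controls_restrict k (W : set 'rV[R]_k) t tau : box t T tau ->
  controls W t `<=` controls W tau.
Proof.
move=> btau w Ww a; have [mw wW] := Ww a.
have sub : box tau T `<=` box t T.
  by move=> s bs b; rewrite (le_trans (box_le btau b) (box_le bs b)) (box_ge bs).
split; last by move=> s /sub; exact: wW.
exact: (borel_funS (borel_closed (@closed_box t T)) sub mw).
Qed.

(** Each branch has to be Borel on its own piece only: the second control of a concatenation is
    admissible only after the step. *)
Lemma borel_fun_if (k l : nat) (D : set 'rV[R]_k) (A : pred 'rV[R]_k)
    (f g : 'rV[R]_k -> 'rV[R]_l) :
  borel_fun (D `&` [set z | A z]) f -> borel_fun (D `&` [set z | ~~ A z]) g ->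
  @measurable _ (g_sigma_algebraType (@open 'rV[R]_k)) [set z | A z] ->
  borel_fun D (fun z => if A z then f z else g z).
Proof.
move=> mf mg mA mD Y mY.
have mDA : @measurable _ (g_sigma_algebraType (@open 'rV[R]_k)) (D `&` [set z | A z]).
  exact: measurableI.
have mDA' : @measurable _ (g_sigma_algebraType (@open 'rV[R]_k)) (D `&` [set z | ~~ A z]).
  apply: measurableI => //.
  rewrite (_ : [set z | ~~ A z] = ~` [set z | A z]); first exact: measurableC.
  by apply/seteqP; split => z /= /negP.
have := measurableU _ _ (mf mDA Y mY) (mg mDA' Y mY).
congr (measurable _); apply/seteqP; split => z /=.
  by case=> -[[Ds As]]; rewrite ?As ?(negbTE As).
by case=> Ds; case: ifPn => As Ys; [left|right].
Qed.

Lemma borel_fun_comp (k l j : nat) (D : set 'rV[R]_k)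
    (f : 'rV[R]_l -> 'rV[R]_j) (g : 'rV[R]_k -> 'rV[R]_l) :
  borel_fun setT f -> borel_fun D g -> borel_fun D (f \o g).
Proof.
move=> mf mg mD Y mY; rewrite comp_preimage; apply: mg => //.
by rewrite -[_ @^-1` _]setTI; exact: mf.
Qed.

(* The face s_a = r goes to w2: it may contain whole curves starting at its lower
   corner, whereas a segment arriving there only meets it at its end point. *)
Definition concat_ctrl k a (r : R) (w1 w2 : 'I_m -> 'rV[R]_m -> 'rV[R]_k) :=
  fun b (s : 'rV[R]_m) => if s 0 a < r then w1 b s else w2 b s.

Lemma box_axis t a h : box 0 T t -> 0 <= h -> t 0 a + h <= T 0 a ->
  box t T (axis_step t a h).
Proof.
move=> bt h0 th b; rewrite axis_step_coord; case: eqP => [->|_].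
  by rewrite lerDl h0 th.
by rewrite addr0 lexx (box_ge bt).
Qed.

Lemma box_axis_step t s tau a h : box t tau s -> t 0 a + h <= s 0 a ->
  box (axis_step t a h) tau s.
Proof.
move=> bs ths b; rewrite axis_step_coord (box_ge bs).
by case: eqP => [->|_]; rewrite ?addr0 ?ths ?(box_le bs).
Qed.

Lemma box_axis_step_ge t s tau a h : box (axis_step t a h) tau s -> t 0 a + h <= s 0 a.
Proof. by move=> /box_le/(_ a); rewrite axis_step_coord eqxx. Qed.

(** The points of [box t T] left to [w2] all lie in the box that starts at [axis_step t a h],
    because the step follows a single axis. *)
Lemma controls_concat k (W : set 'rV[R]_k) t a h w1 w2 :
  controls W t w1 -> controls W (axis_step t a h) w2 ->
  controls W t (concat_ctrl a (t 0 a + h) w1 w2).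
Proof.
move=> Ww1 Ww2 b; have [m1 W1] := Ww1 b; have [m2 W2] := Ww2 b.
have bs' s : (box t T `&` [set s : 'rV[R]_m | ~~ (s 0 a < t 0 a + h)]) s ->
    box (axis_step t a h) T s.
  by move=> [bs] /=; rewrite -leNgt; exact: box_axis_step.
split.
  apply: borel_fun_if.
  - by apply: borel_funS m1; [exact: borel_closed (@closed_box _ _)|move=> s []].
  - by apply: borel_funS m2; [exact: borel_closed (@closed_box _ _)|exact: bs'].
  - apply: borel_open.
    apply: (@open_comp _ _ (fun s : 'rV[R]_m => s 0 a) [set r | r < t 0 a + h]).
      by move=> s _; exact: coord_continuous.
    exact: open_lt.
move=> s bs; rewrite /concat_ctrl; case: ifPn => sa; first exact: W1.
by apply/W2/bs'; split.
Qed.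

End Boxes.

(** * Flow property of states and payoffs *)

Section Trajectories.
Context {R : realType} {m n p q : nat}.
Variable G : game R m n p q.
Hypothesis hG : standing_assumptions G.
Local Notation T := (horizon G).
Implicit Types (t tau s : 'rV[R]_m) (x : 'rV[R]_n) (a : 'I_m).
Implicit Types (u : 'I_m -> 'rV[R]_m -> 'rV[R]_p) (v : 'I_m -> 'rV[R]_m -> 'rV[R]_q).
Implicit Types (y : 'rV[R]_m -> 'rV[R]_n).

Lemma stateP t x u v : box 0 T t -> U G t u -> V G t v ->
  trajectory G t x u v (state G t x u v).
Proof.
move=> bt Uu Vv; have [y ty _] := game_m_flow hG x bt Uu Vv.
exact: (@xgetPex _ (fun=> x) [set y | trajectory G t x u v y] (ex_intro _ y ty)).
Qed.

Lemma state_unique t x u v y : box 0 T t -> U G t u -> V G t v ->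
  trajectory G t x u v y -> forall s, box t T s -> y s = state G t x u v s.
Proof.
move=> bt Uu Vv ty s bs; have [z _ zu] := game_m_flow hG x bt Uu Vv.
by rewrite (zu _ ty s bs) (zu _ (stateP x bt Uu Vv) s bs).
Qed.

(** The segment from [t] to [t] has zero increments. *)
Lemma trajectory_start t x u v y : (forall a, t 0 a <= T 0 a) ->
  trajectory G t x u v y -> y t = x.
Proof.
move=> tT ty; have ct := increasing_segment (fun a => lexx (t 0 a)).
apply/rowP => i; have [_ ->] := ty t (box_refl tT) _ ct i.
rewrite [X in _ + X](_ : _ = 0) ?addr0//; apply: big1 => a _.
under eq_Rintegral do rewrite line_integrand_segment !mxE subrr mulr0.
by rewrite Rintegral_cst// mul0r.
Qed.

(** The equation along [gamma] preceded by the segment from [t] to [tau] is compared with the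
    equation along that segment alone. *)
Lemma trajectory_restrict t tau x u v y : box 0 T t -> box t T tau ->
  trajectory G t x u v y -> trajectory G tau (y tau) u v y.
Proof.
move=> bt btau ty s bs gamma cgamma i F.
have cseg := increasing_segment (box_le btau).
have bs' := box_trans bt btau bs.
have [Fi ys] := ty s bs' _ (increasing_curve_concat cseg cgamma) i.
have [_ F2 FI] := line_integral_concat Fi.
split; first exact: F2.
have [_ ytau] := ty tau btau _ cseg i.
move: ys ytau; rewrite -/F FI => -> ->; exact: addrA.
Qed.

Lemma U_restrict t tau u : box t T tau -> U G t u -> U G tau u.
Proof. by move=> btau; exact: (controls_restrict (W := uvals G) btau). Qed.

Lemma V_restrict t tau v : box t T tau -> V G t v -> V G tau v.
Proof. by move=> btau; exact: (controls_restrict (W := vvals G) btau). Qed.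

Lemma state_flow t tau x u v s : box 0 T t -> box t T tau -> U G t u -> V G t v ->
  box tau T s -> state G tau (state G t x u v tau) u v s = state G t x u v s.
Proof.
move=> bt btau Uu Vv bs; apply/esym; apply: state_unique => //.
- exact: box0_trans btau.
- exact: U_restrict Uu.
- exact: V_restrict Vv.
- exact: trajectory_restrict btau (stateP x bt Uu Vv).
Qed.

(** Path independence concerns curves that end at [T], so the segment to [s] is prolonged by the
    segment from [s] to [T]. *)
Lemma running_cost_integrable t s x u v y : box 0 T t -> U G t u -> V G t v ->
  trajectory G t x u v y -> box t T s ->
  line_integrable (running_cost G u v y) (segment t s).
Proof.
move=> bt Uu Vv ty bs.
have [c cP] := game_path_independent hG bt Uu Vv ty.
have [Fi _] := cP _ (increasing_curve_concat (increasing_segment (box_le bs))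
  (increasing_segment (box_ge bs))).
by have [] := line_integral_concat Fi.
Qed.

(** Path independence replaces the segment from [t] to [T] by the broken line through [tau]; the
    flow property identifies the states on its second part. *)
Lemma payoff_split t tau x u v : box 0 T t -> box t T tau -> U G t u -> V G t v ->
  payoff G t x u v =
  line_integral (running_cost G u v (state G t x u v)) (segment t tau) +
  payoff G tau (state G t x u v tau) u v.
Proof.
move=> bt btau Uu Vv; have ty := stateP x bt Uu Vv.
have [c cP] := game_path_independent hG bt Uu Vv ty.
have tT a : t 0 a <= T 0 a := box_ge bt a.
have tauT a : tau 0 a <= T 0 a := box_ge btau a.
have [Fi Fc] := cP _ (increasing_curve_concat (increasing_segment (box_le btau))
  (increasing_segment tauT)).
have [_ Tc] := cP _ (increasing_segment tT).
have [_ _] := line_integral_concat Fi.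
rewrite /payoff Tc Fc => ->; rewrite -addrA; congr (_ + (_ + _)).
  apply: line_integral_eq => a r r01; rewrite /running_cost state_flow//.
  exact: increasing_curve_box (increasing_segment tauT) r01.
by rewrite state_flow//; exact: box_end.
Qed.

Lemma trajectory_ext t x u u' v v' y :
  eq_ctrl_on (box t T) u u' -> eq_ctrl_on (box t T) v v' ->
  trajectory G t x u v y -> trajectory G t x u' v' y.
Proof.
move=> uu' vv' ty s bs gamma cgamma i F.
have [Fi ys] := ty s bs gamma cgamma i.
have E a r : 0 <= r <= 1 ->
    dyn G a (gamma r) (y (gamma r)) (u a (gamma r)) (v a (gamma r)) 0 i = F a (gamma r).
  move=> r01; have b := box_trans_left bs (increasing_curve_box cgamma r01).
  by rewrite /F uu'// vv'.
split; first exact: line_integrable_eq E Fi.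
by rewrite ys; congr (_ + _); exact: line_integral_eq E.
Qed.

(** The equality holds even outside the box, because both states are chosen from the same set of
    trajectories. *)
Lemma state_ext t x u u' v v' :
  eq_ctrl_on (box t T) u u' -> eq_ctrl_on (box t T) v v' ->
  state G t x u v = state G t x u' v'.
Proof.
move=> uu' vv'; congr xget; apply/seteqP; split => y /=.
  exact: trajectory_ext.
by apply: trajectory_ext => a s bs; [rewrite uu'|rewrite vv'].
Qed.

Lemma payoff_ext t x u u' v v' : box 0 T t ->
  eq_ctrl_on (box t T) u u' -> eq_ctrl_on (box t T) v v' ->
  payoff G t x u v = payoff G t x u' v'.
Proof.
move=> bt uu' vv'; rewrite /payoff (state_ext x uu' vv'); congr (_ + _).
apply: line_integral_eq => a r r01.
have b := increasing_curve_box (increasing_segment (box_ge bt)) r01.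
by rewrite /running_cost uu'// vv'.
Qed.

(** Makes the real-valued [sup] and [inf] in the value functions meaningful. *)
Lemma payoff_bounded : exists B : R, forall t x u v, box 0 T t -> U G t u -> V G t v ->
  `|payoff G t x u v| <= B.
Proof.
have [C Cge0 LC] : exists2 C : R, 0 <= C & forall a t x b c,
    box 0 T t -> uvals G b -> vvals G c -> `|cost G a t x b c| <= C.
  have /choice[C CP] : forall a, exists C : R, forall t x b c,
    box 0 T t -> uvals G b -> vvals G c -> `|cost G a t x b c| <= C.
    by move=> a; exact: cost_bounded hG a.
  (* This sum is nonnegative and dominates the bounds of all axes at once. *)
  exists (\sum_a `|C a|); first by apply: sumr_ge0.
  move=> a t x b c bt Ub Vc; apply: le_trans (CP a t x b c bt Ub Vc) _.
  by rewrite (bigD1 a)//= ler_wpDr ?ler_norm// sumr_ge0.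
have [D gD] := terminal_bounded hG.
exists (\sum_a C * T 0 a + D) => t x u v bt Uu Vv.
apply: le_trans (ler_normD _ _) _; apply: lerD; last exact: gD.
have tT a : t 0 a <= T 0 a := box_ge bt a.
apply: le_trans (@line_integral_segment_bound _ _ _ _ _ C tT _ _) _.
- exact: running_cost_integrable (stateP x bt Uu Vv) (box_end tT).
- move=> a s bs; apply: LC; first exact: box0_trans bs.
    by have [_] := Uu a; apply.
  by have [_] := Vv a; apply.
apply: ler_sum => a _; rewrite ler_wpM2l// lerBlDr lerDl.
by have := box_le bt a; rewrite mxE.
Qed.

End Trajectories.

(** * States along one step in the direction of a time axis *)

Section AxisStep.
Context {R : realType} {m n p q : nat}.
Variable G : game R m n p q.
Hypothesis hG : standing_assumptions G.
Local Notation T := (horizon G).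
Implicit Types (t tau s : 'rV[R]_m) (x : 'rV[R]_n) (a : 'I_m) (h r : R).
Implicit Types (u : 'I_m -> 'rV[R]_m -> 'rV[R]_p) (v : 'I_m -> 'rV[R]_m -> 'rV[R]_q).
Implicit Types (y : 'rV[R]_m -> 'rV[R]_n).
Implicit Types (F : 'I_m -> 'rV[R]_m -> R).

Lemma line_integral_axis_dist F F' t a h (k : R) : 0 <= h ->
  line_integrable F (segment t (axis_step t a h)) ->
  line_integrable F' (segment t (axis_step t a h)) ->
  (forall r, 0 < r < 1 ->
    `|F a (axis_step t a (r * h)) - F' a (axis_step t a (r * h))| <= k) ->
  `|line_integral F (segment t (axis_step t a h)) -
    line_integral F' (segment t (axis_step t a h))| <= h * k.
Proof.
move=> h0 Fi F'i FF'.
have [ki ke] := line_integral_axis_cst t a h k.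
have [FDi FDe] := line_integralD Fi ki.
have [F'Di F'De] := line_integralD F'i ki.
rewrite ler_distlC -ke lerBlDr -FDe -F'De; apply/andP; split;
  apply: line_integral_axis_le => // r r01; move: (FF' r r01);
  by rewrite ler_distlC lerBlDr => /andP[].
Qed.

Lemma norm_axis_step t a h : 0 <= h -> `|axis_step t a h - t| <= h.
Proof.
move=> h0; apply: norm_le_coord => // b; rewrite axis_stepB !mxE eqxx /=.
by case: eqP => _; rewrite ?mulr1 ?mulr0 ?normr0// ger0_norm.
Qed.

Lemma trajectory_axis t a h x u v y : box 0 T t -> 0 <= h -> t 0 a + h <= T 0 a ->
  trajectory G t x u v y ->
  forall i, let F b s := dyn G b s (y s) (u b s) (v b s) 0 i in
    line_integrable F (segment t (axis_step t a h)) /\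
    y (axis_step t a h) 0 i = x 0 i + line_integral F (segment t (axis_step t a h)).
Proof.
move=> bt h0 th ty i; have bs := box_axis bt h0 th.
exact: ty bs _ (increasing_segment (box_le bs)) i.
Qed.

Lemma U_val t u a s : U G t u -> box t T s -> uvals G (u a s).
Proof. by move=> Uu; have [_] := Uu a; apply. Qed.

Lemma V_val t v a s : V G t v -> box t T s -> vvals G (v a s).
Proof. by move=> Vv; have [_] := Vv a; apply. Qed.

Lemma box_axis_itv t a h r : box 0 T t -> t 0 a + h <= T 0 a -> 0 < h -> 0 < r < 1 ->
  box t T (axis_step t a (r * h)).
Proof.
move=> bt th h0 /andP[r0 r1]; apply: box_axis => //; first by rewrite mulr_ge0 ?ltW.
by apply: le_trans th; rewrite lerD2l ger_pMl// ltW.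
Qed.

Lemma trajectory_axis_bound a (C : R) t x u v y h :
  (forall t x b c, box 0 T t -> uvals G b -> vvals G c -> `|dyn G a t x b c| <= C) ->
  box 0 T t -> U G t u -> V G t v -> trajectory G t x u v y ->
  0 <= h -> t 0 a + h <= T 0 a -> `|y (axis_step t a h) - x| <= h * `|C|.
Proof.
move=> XC bt Uu Vv ty h0 th; apply: norm_le_coord; first by rewrite mulr_ge0.
move=> i; rewrite !mxE.
have [Fi ->] := trajectory_axis bt h0 th ty i.
have [zi ze] := line_integral0 (segment t (axis_step t a h)).
rewrite addrAC subrr add0r.
(* For [h = 0] the integrand vanishes; this case is apart because [box_axis_itv] asks for a positive
   step. *)
move: h0; rewrite le_eqVlt => /predU1P[h0|h0].
  rewrite -h0 mul0r line_integral_axis.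
  under eq_Rintegral do rewrite line_integrand_axis mulr0.
  by rewrite Rintegral_cst// mul0r normr0.
rewrite -[X in `|X|]subr0 -[X in _ - X]ze.
apply: line_integral_axis_dist => //; first exact: ltW.
move=> r r01; have b := box_axis_itv bt th h0 r01.
rewrite subr0; apply: le_trans (coord_le_norm _ _) _.
apply: le_trans (ler_norm C); apply: XC; first exact: box0_trans b.
  exact: U_val b.
exact: V_val b.
Qed.

(* The difference of the two states is at most half its own supremum along the
   step, because h K <= 1/2. *)
Lemma trajectory_axis_agree a (K : R) t x u u' v v' y y' h :
  0 <= K ->
  (forall t x x' b c, box 0 T t -> uvals G b -> vvals G c ->
    `|dyn G a t x b c - dyn G a t x' b c| <= K * `|x - x'|) ->
  0 < h -> h * K <= 2^-1 -> t 0 a + h <= T 0 a ->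
  box 0 T t -> U G t u -> U G t u' -> V G t v -> V G t v' ->
  (forall r, 0 <= r < h -> u a (axis_step t a r) = u' a (axis_step t a r)) ->
  (forall r, 0 <= r < h -> v a (axis_step t a r) = v' a (axis_step t a r)) ->
  trajectory G t x u v y -> trajectory G t x u' v' y' ->
  forall r, 0 <= r <= h -> y (axis_step t a r) = y' (axis_step t a r).
Proof.
move=> K0 Klip h0 hK th bt Uu Uu' Vv Vv' uu' vv' ty ty'.
pose d r := `|y (axis_step t a r) - y' (axis_step t a r)|.
pose D := [set d r | r in [set r | 0 <= r <= h]].
have [C XC] := dyn_bounded hG a.
have th' r : r <= h -> t 0 a + r <= T 0 a by move=> rh; apply: le_trans th; rewrite lerD2l.
(* Each state stays within [h * |C|] of [x], so the supremum of the differences is a genuine one. *)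
have Dub : has_ubound D.
  exists (h * `|C| + h * `|C|) => _ [r /andP[r0 rh] <-].
  rewrite /d -[X in X - _](subrK x) -addrA; apply: le_trans (ler_normD _ _) _.
  rewrite [ `|x - _|]distrC; apply: lerD; apply: le_trans (_ : r * `|C| <= _);
    rewrite ?ler_wpM2r//; [exact: (trajectory_axis_bound XC bt Uu Vv ty r0 (th' r rh))|].
  exact: (trajectory_axis_bound XC bt Uu' Vv' ty' r0 (th' r rh)).
have D0 : D !=set0 by exists (d 0), 0 => //=; rewrite lexx ltW.
have dS r : 0 <= r <= h -> d r <= sup D by move=> rh; apply: ub_le_sup => //; exists r.
have S0 : 0 <= sup D.
  by apply: le_trans (normr_ge0 _) (dS 0 _); rewrite lexx ltW.
have Shalf : sup D <= 2^-1 * sup D.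
  apply: ge_sup => // _ [r /andP[r0 rh] <-].
  have SK : r * (K * sup D) <= 2^-1 * sup D.
    by rewrite mulrA ler_wpM2r// (le_trans _ hK)// ler_wpM2r.
  apply: le_trans SK; apply: norm_le_coord.
    by rewrite !mulr_ge0.
  move=> i; rewrite !mxE.
  have [Fi ->] := trajectory_axis bt r0 (th' r rh) ty i.
  have [F'i ->] := trajectory_axis bt r0 (th' r rh) ty' i.
  rewrite opprD addrACA subrr add0r.
  apply: line_integral_axis_dist => // z z01.
  have /andP[z0 z1] := z01.
  have zr0 : 0 <= z * r by rewrite mulr_ge0// ltW.
  have zrh' : z * r < h.
    by apply: (@le_lt_trans _ _ (z * h)); rewrite ?gtr_pMl// ler_wpM2l// ltW.
  have zrh : z * r <= h := ltW zrh'.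
  have : 0 <= z * r <= h by rewrite zr0.
  move=> /dS dzr.
  have b := box_axis bt zr0 (th' _ zrh).
  (* Interior points of the segment lie strictly before the end of the step, where the controls are
     known to agree. *)
  rewrite uu' ?zr0// vv' ?zr0//.
  have -> (w w' : 'rV[R]_n) : w 0 i - w' 0 i = (w - w') 0 i by rewrite !mxE.
  apply: le_trans (coord_le_norm _ _) _.
  apply: le_trans (Klip _ _ _ _ _ _ _ _) _.
  - exact: box0_trans b.
  - exact: U_val b.
  - exact: V_val b.
  - by rewrite ler_wpM2l.
have S00 : sup D <= 0 by lra.
move=> r rh; apply/eqP; rewrite -subr_eq0 -normr_le0.
exact: le_trans (dS r rh) S00.
Qed.

End AxisStep.

(** * The Hamiltonian along one step *)

(** Finitely many balls of radius [d] centred in [W] cover [W]; [f c] is the reply chosen for the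
    first centre within [d] of [c]. It therefore suits a point near [c], and uniform continuity
    later absorbs the gap. *)
Lemma borel_selection {R : realType} {k l : nat} (W : set 'rV[R]_k) (Z : set 'rV[R]_l)
    (Q : 'rV[R]_k -> 'rV[R]_l -> Prop) (d : R) :
  compact W -> Z !=set0 -> 0 < d ->
  (forall c, W c -> exists2 b, Z b & Q c b) ->
  exists f : 'rV[R]_k -> 'rV[R]_l, [/\ forall c, Z (f c), borel_fun setT f &
    forall c, W c -> exists c', [/\ W c', `|c - c'| < d & Q c' (f c)]].
Proof.
move=> cW [z0 Zz0] d0 WQ.
(* Outside [W] the reply is [z0], so that [g] takes all its values in [Z]. *)
have /choice[g gP] : forall c, exists b, Z b /\ (W c -> Q c b).
  move=> c; have [Wc|nWc] := pselect (W c); last by exists z0.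
  by have [b Zb Qb] := WQ c Wc; exists b.
pose D c : set 'rV[R]_k := ball c d.
have DE c c' : D c c' = (`|c' - c| < d) by rewrite /D -ball_normE /= distrC.
have Dopen c : open (D c) by exact: ball_open.
move: cW; rewrite compact_cover => cW.
have [E EW WE] : finite_subset_cover W D W.
  apply: cW => [c _|c Wc]; first exact: Dopen.
  by exists c => //; exact: ballxx.
pose f := foldr (fun c0 (h : 'rV[R]_k -> 'rV[R]_l) c =>
  if `|c - c0| < d then g c0 else h c) (fun=> z0) (enum_fset E).
exists f; rewrite /f; split.
- by move=> c; elim: (enum_fset E) => //= c0 s ih; case: ifP => _ //; case: (gP c0).
- elim: (enum_fset E) => /= [|c0 s ih]; first exact: measurable_cst.
  apply: borel_fun_if.
  + exact: measurable_cst.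
  + apply: borel_funS ih; last by [].
    exact: measurableT.
  + by apply: borel_open; have := Dopen c0; congr open; apply/seteqP; split => c;
      rewrite DE.
move=> c /WE [c1 /= c1E]; rewrite DE => Dc1.
have : {subset enum_fset E <= W} by move=> z zE; exact: EW.
have : exists2 c1, c1 \in enum_fset E & `|c - c1| < d by exists c1.
elim: (enum_fset E) => /= [[]//|c0 s ih] [c2 + c2d] sW; rewrite in_cons.
case: ifPn => [cc0 _|ncc0].
  exists c0; have Wc0 : W c0 by apply/set_mem/sW; rewrite mem_head.
  by split => //; exact: (gP c0).2.
move=> /predU1P[c2c0|c2s]; first by move: ncc0; rewrite -c2c0 c2d.
by apply: ih; [exists c2|move=> z zs; apply: sW; rewrite in_cons zs orbT].
Qed.

Section Hamiltonian.
Context {R : realType} {m n p q : nat}.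
Variable G : game R m n p q.
Hypothesis hG : standing_assumptions G.
Local Notation T := (horizon G).
Implicit Types (t tau s : 'rV[R]_m) (x P : 'rV[R]_n) (a : 'I_m) (h r : R).
Implicit Types (u : 'I_m -> 'rV[R]_m -> 'rV[R]_p) (v : 'I_m -> 'rV[R]_m -> 'rV[R]_q).
Implicit Types (y : 'rV[R]_m -> 'rV[R]_n).

Definition pre_hamiltonian a P t x b c := dot P (dyn G a t x b c) + cost G a t x b c.

Lemma pre_hamiltonian_bounded a P : data_bounded G (pre_hamiltonian a P).
Proof.
have [C CP] := dyn_bounded hG a; have [D DP] := cost_bounded hG a.
exists (n%:R * `|P| * C + D) => t x b c bt Ub Vc.
apply: le_trans (ler_normD _ _) _; apply: lerD; last exact: DP.
by apply: le_trans (norm_dot_le _ _) _; rewrite ler_wpM2l ?mulr_ge0//; exact: CP.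
Qed.

Lemma pre_hamiltonian_unif_continuous a P :
  data_unif_continuous G (pre_hamiltonian a P).
Proof.
move=> e e0; have e20 : 0 < e / 2 by rewrite divr_gt0.
(* The added [1] keeps the divisor positive when [P] is zero. *)
have nP0 : 0 < n%:R * `|P| + 1 by rewrite ltr_wpDl// mulr_ge0.
have [d1 d10 d1P] := dyn_unif_continuous hG a (divr_gt0 e20 nP0).
have [d2 d20 d2P] := cost_unif_continuous hG a e20.
exists (Num.min d1 d2) => [|t x b c t' x' b' c' bt Ub Vc bt' Ub' Vc'].
  by rewrite lt_min d10.
rewrite !lt_min => /andP[t1 t2] /andP[x1 x2] /andP[b1 b2] /andP[c1 c2].
rewrite /pre_hamiltonian opprD addrACA -dotBr.
apply: le_lt_trans (ler_normD _ _) _; rewrite [e]splitr.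
apply: ler_ltD; last exact: d2P.
apply: le_trans (norm_dot_le _ _) _.
have := d1P _ _ _ _ _ _ _ _ bt Ub Vc bt' Ub' Vc' t1 x1 b1 c1.
rewrite ltr_pdivlMr// => /ltW; apply: le_trans.
by rewrite mulrC ler_wpM2l// ler_wpDr.
Qed.

(** The state increment is itself a line integral of the dynamics. Its product with [P] joins the
    cost in a single integrand, which can then be bounded pointwise. *)
Lemma trajectory_work t a h P x u v y : box 0 T t -> 0 <= h -> t 0 a + h <= T 0 a ->
  U G t u -> V G t v -> trajectory G t x u v y ->
  let F b s := pre_hamiltonian b P s (y s) (u b s) (v b s) in
  line_integrable F (segment t (axis_step t a h)) /\
  line_integral F (segment t (axis_step t a h)) =
  dot P (y (axis_step t a h) - x) +
  line_integral (running_cost G u v y) (segment t (axis_step t a h)).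
Proof.
move=> bt h0 th Uu Vv ty F.
have Xi i := (trajectory_axis bt h0 th ty i).1.
have [Di De] := line_integral_dot P Xi.
have Li := running_cost_integrable hG bt Uu Vv ty (box_axis bt h0 th).
have [Fi Fe] := line_integralD Di Li; split; first exact: Fi.
rewrite Fe De; congr (_ + _); apply: eq_bigr => i _; congr (_ * _).
by rewrite !mxE (trajectory_axis bt h0 th ty i).2 addrAC subrr add0r.
Qed.

(** The threshold [h0] is uniform in the controls since the dynamics are bounded; this lets the
    controls be chosen after the step length. *)
Lemma near_axis_step a t x (Q : 'rV[R]_m * 'rV[R]_n -> Prop) :
  box 0 T t -> t 0 a < T 0 a ->
  (\forall z \near within [set z : 'rV[R]_m * 'rV[R]_n | box 0 T z.1] (nbhs (t, x)), Q z) ->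
  exists2 h0, 0 < h0 & forall h u v y, 0 <= h < h0 ->
    U G t u -> V G t v -> trajectory G t x u v y ->
    t 0 a + h <= T 0 a /\ Q (axis_step t a h, y (axis_step t a h)).
Proof.
move=> bt tT /nbhs_ballP[e /= e0 eQ].
have [C XC] := dyn_bounded hG a.
have C0 : 0 < 1 + `|C| by rewrite ltr_wpDr.
(* The first term keeps the step before the horizon, the second keeps the time and the state within
   [e] of [(t, x)]. *)
exists (Num.min (T 0 a - t 0 a) (e / (1 + `|C|))).
  by rewrite lt_min subr_gt0 tT divr_gt0.
move=> h u v y /andP[h0]; rewrite lt_min ltrBrDl ltr_pdivlMr// => /andP[/ltW th he] Uu Vv ty.
split=> //; apply: eQ; last exact: box0_trans (box_axis bt h0 th).
split; rewrite /= -ball_normE /= distrC.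
  apply: le_lt_trans (norm_axis_step _ _ h0) _; apply: le_lt_trans he.
  by rewrite ler_peMr// lerDl.
apply: le_lt_trans (trajectory_axis_bound XC bt Uu Vv ty h0 th) _.
by apply: le_lt_trans he; rewrite ler_wpM2l// lerDr.
Qed.

Lemma near_axis_step_itv a t x (Q : 'rV[R]_m * 'rV[R]_n -> Prop) :
  box 0 T t -> t 0 a < T 0 a ->
  (\forall z \near within [set z : 'rV[R]_m * 'rV[R]_n | box 0 T z.1] (nbhs (t, x)), Q z) ->
  exists2 h0, 0 < h0 & forall h u v y, 0 < h < h0 ->
    U G t u -> V G t v -> trajectory G t x u v y ->
    forall r, 0 < r < 1 -> Q (axis_step t a (r * h), y (axis_step t a (r * h))).
Proof.
move=> bt tT nQ; have [h0 h00 hQ] := near_axis_step bt tT nQ.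
exists h0 => // h u v y /andP[h1 h2] Uu Vv ty r /andP[r0 r1].
have rh : 0 <= r * h < h0.
  by rewrite mulr_ge0 ?ltW//= (lt_trans _ h2)// gtr_pMl.
exact: (hQ _ u v y rh Uu Vv ty).2.
Qed.

(* One step along the axis a: omega(t', y(t')) - omega(t, x) + work is, up to
   o(h), an average of d omega/dt^a + pre_hamiltonian over the step. *)
Lemma axis_step_estimate a t x omega dt dx (e : R) :
  box 0 T t -> t 0 a < T 0 a -> 0 < e ->
  C1_with_gradient [set z : 'rV[R]_m * 'rV[R]_n | box 0 T z.1] omega dt dx ->
  exists2 h0, 0 < h0 & forall h u v y, 0 < h < h0 ->
    U G t u -> V G t v -> trajectory G t x u v y ->
    let D := omega (axis_step t a h, y (axis_step t a h)) - omega (t, x) +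
      line_integral (running_cost G u v y) (segment t (axis_step t a h)) in
    forall k,
    ((forall r, 0 < r < 1 -> pre_hamiltonian a (dx (t, x)) t x
        (u a (axis_step t a (r * h))) (v a (axis_step t a (r * h))) <= k) ->
      D <= h * (dt (t, x) 0 a + k + e)) /\
    ((forall r, 0 < r < 1 -> k <= pre_hamiltonian a (dx (t, x)) t x
        (u a (axis_step t a (r * h))) (v a (axis_step t a (r * h)))) ->
      h * (dt (t, x) 0 a + k - e) <= D).
Proof.
move=> bt tT e0 [_ _ domega].
set P := dx (t, x).
have e20 : 0 < e / 2 by rewrite divr_gt0.
have [C XC] := dyn_bounded hG a.
have C0 : 0 < 1 + `|C| by rewrite ltr_wpDr.
(* The point moves by at most [h * (1 + |C|)], so the linearization error is at most [h * (e / 2)];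
   the other half of [e] pays for freezing the time and the state at [(t, x)]. *)
have [h1 h10 h1P] := near_axis_step bt tT (domega (t, x) bt _ (divr_gt0 e20 C0)).
have [d d0 dP] := pre_hamiltonian_unif_continuous a P e20.
have [h2 h20 h2P] : exists2 h0, 0 < h0 & forall h u v y, 0 < h < h0 ->
    U G t u -> V G t v -> trajectory G t x u v y ->
    forall r, 0 < r < 1 ->
    `|axis_step t a (r * h) - t| < d /\ `|y (axis_step t a (r * h)) - x| < d.
  apply: (near_axis_step_itv (Q := fun z => `|z.1 - t| < d /\ `|z.2 - x| < d)) => //.
  apply/nbhs_ballP; exists d => //= z [/=]; rewrite -!ball_normE /= => zt zx _.
  by rewrite distrC zt distrC zx.
exists (Num.min h1 h2); first by rewrite lt_min h10.
move=> h u v y /andP[h0]; rewrite lt_min => /andP[hh1 hh2] Uu Vv ty D k.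
have h01 : 0 <= h < h1 by rewrite ltW.
have [th /=] := h1P h u v y h01 Uu Vv ty.
have /ltW h0' := h0.
set D1 := omega _ - omega _; set D2 := dot _ _ + _.
have -> : D2 = h * dt (t, x) 0 a + dot P (y (axis_step t a h) - x).
  rewrite /D2 axis_stepB; congr (_ + _); rewrite /dot (bigD1 a)//= big1.
    by rewrite !mxE !eqxx mulr1 addr0 mulrC.
  by move=> b /negbTE ba; rewrite !mxE eqxx ba !mulr0.
move=> dD.
have {}dD : `|D1 - (h * dt (t, x) 0 a + dot P (y (axis_step t a h) - x))| <= h * (e / 2).
  apply: le_trans dD _.
  have zle : `|(axis_step t a h, y (axis_step t a h)) - (t, x)| <= h * (1 + `|C|).
    rewrite prod_normE ge_max /=; apply/andP; split.
      by apply: le_trans (norm_axis_step _ _ h0') _; rewrite ler_peMr// lerDl.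
    apply: le_trans (trajectory_axis_bound XC bt Uu Vv ty h0' th) _.
    by rewrite ler_wpM2l// lerDr.
  apply: le_trans (ler_wpM2l _ zle) _; first by rewrite divr_ge0 ?ltW.
  by rewrite mulrCA divfK// gt_eqF.
have [Fi Fe] := trajectory_work P bt h0' th Uu Vv ty.
have h02 : 0 < h < h2 by rewrite h0.
have close r : 0 < r < 1 ->
    `|pre_hamiltonian a P (axis_step t a (r * h)) (y (axis_step t a (r * h)))
       (u a (axis_step t a (r * h))) (v a (axis_step t a (r * h))) -
      pre_hamiltonian a P t x (u a (axis_step t a (r * h))) (v a (axis_step t a (r * h)))|
    < e / 2.
  move=> r01; have bs := box_axis_itv bt th h0 r01.
  have [c1 c2] := h2P h u v y h02 Uu Vv ty r r01.
  by apply: dP => //; rewrite ?subrr ?normr0//; by [exact: box0_trans bs|exact: U_val bs|exact: V_val bs].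
split=> hk.
  have [ki ke] := line_integral_axis_cst t a h (k + e / 2).
  have := line_integral_axis_le h0' Fi ki.
  rewrite ke Fe => /(_ _)/wrap[r r01|].
    by have := close r r01; have := hk r r01; rewrite ltr_norml; lra.
  by move: dD; rewrite ler_norml /D -/D1; lra.
have [ki ke] := line_integral_axis_cst t a h (k - e / 2).
have := line_integral_axis_le h0' ki Fi.
rewrite ke Fe => /(_ _)/wrap[r r01|].
  by have := close r r01; have := hk r r01; rewrite ltr_norml; lra.
by move: dD; rewrite ler_norml /D -/D1; lra.
Qed.

End Hamiltonian.

(** * Dynamic programming and the upper value *)

Section UpperValue.
Context {R : realType} {m n p q : nat}.
Variable G : game R m n p q.
Hypothesis hG : standing_assumptions G.
Local Notation T := (horizon G).
Implicit Types (t tau s : 'rV[R]_m) (x P : 'rV[R]_n) (a : 'I_m) (h r e : R).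
Implicit Types (u : 'I_m -> 'rV[R]_m -> 'rV[R]_p) (v : 'I_m -> 'rV[R]_m -> 'rV[R]_q).
Implicit Types (y : 'rV[R]_m -> 'rV[R]_n).

Lemma controls_cst k (W : set 'rV[R]_k) (c : 'rV[R]_k) t :
  W c -> controls (T := T) W t (fun _ _ => c).
Proof. by move=> Wc a; split => //; exact: measurable_cst. Qed.

Lemma U_neq0 t : U G t !=set0.
Proof.
by have [b Ub] := uvals_neq0 hG; exists (fun _ _ => b); exact: (controls_cst t Ub).
Qed.

Lemma V_neq0 t : V G t !=set0.
Proof.
by have [c Vc] := vvals_neq0 hG; exists (fun _ _ => c); exact: (controls_cst t Vc).
Qed.

Lemma ustrategy_neq0 t : ustrategy G t !=set0.
Proof. by have [u Uu] := U_neq0 t; exists (fun _ => u). Qed.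

Lemma has_inf_payoff t x Phi : box 0 T t -> ustrategy G t Phi ->
  has_inf [set payoff G t x (Phi v) v | v in V G t].
Proof.
move=> bt [PhiU _]; have [v Vv] := V_neq0 t; split.
  by exists (payoff G t x (Phi v) v), v.
have [B BP] := payoff_bounded hG; exists (- B) => _ [w Vw <-].
by have := BP t x _ _ bt (PhiU _ Vw) Vw; rewrite ler_norml => /andP[].
Qed.

Lemma has_sup_upper t x : box 0 T t ->
  has_sup [set inf [set payoff G t x (Phi v) v | v in V G t] | Phi in ustrategy G t].
Proof.
move=> bt; have [Phi sPhi] := ustrategy_neq0 t; split.
  by exists (inf [set payoff G t x (Phi v) v | v in V G t]), Phi.
have [B BP] := payoff_bounded hG; exists B => _ [Psi sPsi <-].
have [v Vv] := V_neq0 t.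
apply: (@le_trans _ _ (payoff G t x (Psi v) v)).
  by apply: ge_inf; [exact: (has_inf_payoff x bt sPsi).2|exists v].
by have := BP t x _ _ bt (sPsi.1 _ Vv) Vv; rewrite ler_norml => /andP[].
Qed.

Lemma upper_value_strategy t x e : box 0 T t -> 0 < e ->
  exists2 Phi, ustrategy G t Phi & forall v, V G t v ->
    upper_value G t x - e <= payoff G t x (Phi v) v.
Proof.
move=> bt e0; have [_ [Phi sPhi <-] lt] := sup_adherent e0 (has_sup_upper x bt).
exists Phi => // v Vv; apply: le_trans (ltW lt) _.
by apply: ge_inf; [exact: (has_inf_payoff x bt sPhi).2|exists v].
Qed.

Lemma upper_value_response t x Phi e : box 0 T t -> 0 < e -> ustrategy G t Phi ->
  exists2 v, V G t v & payoff G t x (Phi v) v <= upper_value G t x + e.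
Proof.
move=> bt e0 sPhi; have [_ [v Vv <-] lt] := inf_adherent e0 (has_inf_payoff x bt sPhi).
exists v => //; apply: le_trans (ltW lt) _; rewrite lerD2r.
by apply: ub_le_sup; [exact: (has_sup_upper x bt).2|exists Phi].
Qed.

(** The form of nonanticipation used in dynamic programming. The controls are compared on the
    half-open step, since a concatenated control follows its second piece from the end face on. *)
Definition causal_step a h := forall t x u u' v v',
  box 0 T t -> t 0 a + h <= T 0 a -> U G t u -> U G t u' -> V G t v -> V G t v' ->
  (forall r, 0 <= r < h -> u a (axis_step t a r) = u' a (axis_step t a r)) ->
  (forall r, 0 <= r < h -> v a (axis_step t a r) = v' a (axis_step t a r)) ->
  state G t x u v (axis_step t a h) = state G t x u' v' (axis_step t a h) /\
  line_integral (running_cost G u v (state G t x u v)) (segment t (axis_step t a h)) =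
  line_integral (running_cost G u' v' (state G t x u' v'))
    (segment t (axis_step t a h)).

Lemma causal_step_small a :
  exists2 h0, 0 < h0 & forall h, 0 < h < h0 -> causal_step a h.
Proof.
have [K0 KP] := dyn_lipschitz hG a.
have K1 : 0 < 1 + `|K0| by rewrite ltr_wpDr.
exists (2^-1 / (1 + `|K0|)); first by rewrite divr_gt0.
move=> h /andP[h0]; rewrite ltr_pdivlMr// => /ltW hK.
move=> t x u u' v v' bt th Uu Uu' Vv Vv' uu' vv'.
have ty := stateP hG x bt Uu Vv; have ty' := stateP hG x bt Uu' Vv'.
have Klip t0 x0 x' b c : box 0 T t0 -> uvals G b -> vvals G c ->
    `|dyn G a t0 x0 b c - dyn G a t0 x' b c| <= (1 + `|K0|) * `|x0 - x'|.
  move=> b0 Ub Vc; apply: le_trans (KP _ _ _ _ _ b0 Ub Vc) _.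
  by rewrite ler_wpM2r// (le_trans (ler_norm _))// lerDr.
have agree := trajectory_axis_agree hG (ltW K1) Klip h0 hK th bt Uu Uu' Vv Vv'
  uu' vv' ty ty'.
split; first by apply: agree; rewrite ltW//= lexx.
have Li := running_cost_integrable hG bt Uu Vv ty (box_axis bt (ltW h0) th).
have L'i := running_cost_integrable hG bt Uu' Vv' ty' (box_axis bt (ltW h0) th).
have E r : 0 < r < 1 ->
    running_cost G u v (state G t x u v) a (axis_step t a (r * h)) =
    running_cost G u' v' (state G t x u' v') a (axis_step t a (r * h)).
  move=> /andP[r0 r1]; have rh : 0 <= r * h < h.
    by rewrite mulr_ge0 ?ltW//= gtr_pMl.
  have rh' : 0 <= r * h <= h by case/andP: rh => -> /ltW.
  by rewrite /running_cost (uu' _ rh) (vv' _ rh) (agree _ rh').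
apply/eqP; rewrite eq_le (line_integral_axis_le (ltW h0) Li L'i).
  by rewrite (line_integral_axis_le (ltW h0) L'i Li)// => r /E ->.
by move=> r /E ->.
Qed.

Lemma concat_ctrl_lt k a h t (w w' : 'I_m -> 'rV[R]_m -> 'rV[R]_k) r b : r < h ->
  concat_ctrl a (t 0 a + h) w w' b (axis_step t a r) = w b (axis_step t a r).
Proof. by move=> rh; rewrite /concat_ctrl axis_step_coord eqxx ltrD2l rh. Qed.

Lemma concat_ctrl_box k a h t (w w' : 'I_m -> 'rV[R]_m -> 'rV[R]_k) :
  eq_ctrl_on (box (axis_step t a h) T) (concat_ctrl a (t 0 a + h) w w') w'.
Proof.
by move=> b s bs; rewrite /concat_ctrl ltNge (box_axis_step_ge bs).
Qed.

(** The control sought is [Phi v0], with [Phi] almost optimal at [t]. Prefixing [v0] to later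
    controls turns [Phi] into a strategy at the end of the step, and a good response to it, prefixed
    by [v0], is a play against [Phi]. *)
Lemma upper_dpp_le a h t x v0 e : causal_step a h -> 0 < h ->
  box 0 T t -> t 0 a + h <= T 0 a -> V G t v0 -> 0 < e ->
  exists2 u, U G t u & let y := state G t x u v0 in
    upper_value G t x - e <=
    line_integral (running_cost G u v0 y) (segment t (axis_step t a h)) +
    upper_value G (axis_step t a h) (y (axis_step t a h)).
Proof.
move=> cs h0 bt th Vv0 e0; have e20 : 0 < e / 2 by rewrite divr_gt0.
have bt' := box_axis bt (ltW h0) th; set t' := axis_step t a h in bt' *.
have b0t' := box0_trans bt bt'.
have [Phi sPhi PhiP] := upper_value_strategy x bt e20; have [PhiU Phina] := sPhi.
pose w v := concat_ctrl a (t 0 a + h) v0 v.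
have Vw v : V G t' v -> V G t (w v) by exact: (controls_concat (W := vvals G) Vv0).
have sPhi' : ustrategy G t' (fun v => Phi (w v)).
  split=> [v /Vw Vwv|v v' tau Vv Vv' btau vv'].
    exact: U_restrict bt' (PhiU _ Vwv).
  have bttau : box t T tau := box_trans bt bt' btau.
  have ww' : eq_ctrl_on (box t tau) (w v) (w v').
    move=> b s bs; rewrite /w /concat_ctrl; case: ltP => // sa.
    by apply: vv'; exact: box_axis_step.
  move=> b s bs; apply: Phina bttau ww' _ _ _ => //; [exact: Vw|exact: Vw|].
  by move=> c; rewrite (le_trans (box_le bt' c) (box_le bs c)) (box_ge bs).
exists (Phi v0); first exact: PhiU.
move=> y; have [v2 Vv2 v2P] := upper_value_response (y t') b0t' e20 sPhi'.
have Vw2 := Vw _ Vv2.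
have w2E r b : r < h -> w v2 b (axis_step t a r) = v0 b (axis_step t a r).
  exact: concat_ctrl_lt.
(* For [r < h] the controls [w v2] and [v0] agree on the whole box up to that point, so
   nonanticipation of [Phi] applies there. *)
have Phi2E r : 0 <= r < h ->
    Phi (w v2) a (axis_step t a r) = Phi v0 a (axis_step t a r).
  move=> /andP[r0 rh]; have thr : t 0 a + r <= T 0 a.
    by apply: le_trans th; rewrite lerD2l ltW.
  have br := box_axis bt r0 thr.
  apply: (Phina _ _ _ Vw2 Vv0 br); last exact: box_end (box_le br).
  move=> b s bs; rewrite /w /concat_ctrl ifT//.
  by apply: le_lt_trans (box_ge bs a) _; rewrite axis_step_coord eqxx ltrD2l.
have [ye we] := cs t x _ _ _ _ bt th (PhiU _ Vw2) (PhiU _ Vv0) Vw2 Vv0 Phi2E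
  (fun r rh => w2E r a (proj2 (andP rh))).
have := PhiP _ Vw2.
rewrite (payoff_split hG x bt bt' (PhiU _ Vw2) Vw2) we ye -/y.
rewrite (payoff_ext (y t') b0t' (fun _ _ _ => erefl) (@concat_ctrl_box _ a h t v0 v2)).
by move: v2P; rewrite -/t'; lra.
Qed.

(** [Phi1] is followed, from the end of the step, by an almost optimal strategy for the state
    reached; [v] is an almost optimal response to this combined strategy. *)
Lemma upper_dpp_ge a h t x Phi1 e : causal_step a h -> 0 < h ->
  box 0 T t -> t 0 a + h <= T 0 a -> ustrategy G t Phi1 -> 0 < e ->
  exists u v, [/\ U G t u, V G t v,
    forall r, 0 <= r < h -> u a (axis_step t a r) = Phi1 v a (axis_step t a r) &
    let y := state G t x u v in
    line_integral (running_cost G u v y) (segment t (axis_step t a h)) +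
    upper_value G (axis_step t a h) (y (axis_step t a h)) <= upper_value G t x + e].
Proof.
move=> cs h0 bt th [Phi1U Phi1na] e0; have e20 : 0 < e / 2 by rewrite divr_gt0.
have bt' := box_axis bt (ltW h0) th; set t' := axis_step t a h in bt' *.
have b0t' := box0_trans bt bt'.
(* One almost optimal strategy at [t'] is fixed for each state, so that equal states lead to the
   same continuation. *)
have /choice[Psi PsiP] : forall z, exists Psi, ustrategy G t' Psi /\
    forall v, V G t' v -> upper_value G t' z - e / 2 <= payoff G t' z (Psi v) v.
  by move=> z; have [Psi] := upper_value_strategy z b0t' e20; exists Psi.
pose z v := state G t x (Phi1 v) v t'.
pose Phi v := concat_ctrl a (t 0 a + h) (Phi1 v) (Psi (z v) v).
have PhiU v : V G t v -> U G t (Phi v).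
  move=> Vv; apply: (controls_concat (W := uvals G)); first exact: Phi1U.
  exact: (PsiP (z v)).1.1 (V_restrict bt' Vv).
have sPhi : ustrategy G t Phi.
  split=> // v v' tau Vv Vv' btau vv' b s bs; rewrite /Phi /concat_ctrl.
  have Phi1E := Phi1na _ _ _ Vv Vv' btau vv'.
  case: ltP => sa; first exact: Phi1E.
  have taua : t 0 a + h <= tau 0 a := le_trans sa (box_ge bs a).
  have br r : 0 <= r < h -> box t tau (axis_step t a r).
    move=> /andP[r0 rh] c; rewrite axis_step_coord; case: eqP => [->|_].
      by rewrite lerDl r0 (le_trans _ taua)// lerD2l ltW.
    by rewrite addr0 lexx (box_le btau).
  (* Once [tau] is past the end face, [v] and [v'] agree on the entire step; by causality they reach
     the same state and select the same continuation. *)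
  have -> : z v' = z v.
    by apply/esym; apply: (cs _ _ _ _ _ _ bt th (Phi1U _ Vv) (Phi1U _ Vv') Vv Vv' _ _).1
      => r rh; [exact/Phi1E/br|exact/vv'/br].
  have btau' : box t' T tau := box_axis_step btau taua.
  apply: ((PsiP (z v)).1.2 _ _ _ (V_restrict bt' Vv) (V_restrict bt' Vv') btau').
    by move=> c s' bs'; apply: vv' => d;
      rewrite (le_trans (box_le bt' d) (box_le bs' d)) (box_ge bs').
  exact: box_axis_step.
have [v Vv vP] := upper_value_response x bt e20 sPhi.
have PhiE r : 0 <= r < h -> Phi v a (axis_step t a r) = Phi1 v a (axis_step t a r).
  by case/andP => _; exact: concat_ctrl_lt.
exists (Phi v), v; split => //; first exact: PhiU.
move=> y.
have [ye _] := cs t x _ _ _ _ bt th (PhiU _ Vv) (Phi1U _ Vv) Vv Vv PhiE (fun _ _ => erefl).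
move: vP; rewrite (payoff_split hG x bt bt' (PhiU _ Vv) Vv) -/y.
rewrite (payoff_ext (y t') b0t' (@concat_ctrl_box _ a h t (Phi1 v) _)
  (fun _ _ _ => erefl)).
have := (PsiP (z v)).2 v (V_restrict bt' Vv).
have -> : z v = y t' by exact: esym ye.
by rewrite -/t'; lra.
Qed.

(** * The two viscosity inequalities for the upper value *)

Lemma upper_value_subsolution omega dt dx t x a :
  C1_with_gradient [set z : 'rV[R]_m * 'rV[R]_n | box 0 T z.1] omega dt dx ->
  box 0 T t -> t 0 a < T 0 a ->
  (\forall z \near within [set z : 'rV[R]_m * 'rV[R]_n | box 0 T z.1] (nbhs (t, x)),
    upper_value G z.1 z.2 - omega z <= upper_value G t x - omega (t, x)) ->
  0 <= dt (t, x) 0 a + upper_hamiltonian G a t x (dx (t, x)).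
Proof.
move=> domega bt ta omax; rewrite leNgt; apply/negP.
set H := upper_hamiltonian _ _ _ _ _; set P := dx (t, x) => lt0.
(* The defect is [4 * e]: one [e] is lost in choosing [c], one in the step estimate and one in
   dynamic programming, which leaves one for the contradiction. *)
pose e := - (dt (t, x) 0 a + H) / 4.
have e0 : 0 < e by rewrite divr_gt0// oppr_gt0.
have [c Vc cP] : exists2 c, vvals G c & forall b, uvals G b ->
    pre_hamiltonian G a P t x b c <= H + e.
  have [c0 Vc0] := vvals_neq0 hG.
  have [||_ [c Vc <-] lt] := @inf_lt R [set sup [set pre_hamiltonian G a P t x b c
      | b in uvals G] | c in vvals G] (H + e).
  - by exists (sup [set pre_hamiltonian G a P t x b c0 | b in uvals G]), c0.
  - by change (H < H + e); rewrite ltrDl.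
  exists c => // b Ub; apply: le_trans (ltW lt); apply: ub_le_sup; last by exists b.
  have [B BP] := pre_hamiltonian_bounded hG a P; exists B => _ [b' Ub' <-].
  exact: le_trans (ler_norm _) (BP t x b' c bt Ub' Vc).
have [h1 h10 h1P] := axis_step_estimate hG x bt ta e0 domega.
have [h2 h20 h2P] := near_axis_step hG bt ta omax.
have [h3 h30 h3P] := causal_step_small a.
pose h := Num.min h1 (Num.min h2 h3) / 2.
have hmin0 : 0 < Num.min h1 (Num.min h2 h3) by rewrite !lt_min h10 h20.
have h0 : 0 < h by rewrite divr_gt0.
have : h < Num.min h1 (Num.min h2 h3) by rewrite ltr_pdivrMr// mulr_natr mulr2n ltrDl.
rewrite !lt_min => /and3P[hh1 hh2 hh3].
pose v0 : 'I_m -> 'rV[R]_m -> 'rV[R]_q := fun _ _ => c.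
have Vv0 : V G t v0 := controls_cst t Vc.
have [u0 Uu0] := U_neq0 t.
(* [near_axis_step] gives this bound along a trajectory, so arbitrary controls are supplied. *)
have th : t 0 a + h <= T 0 a.
  by apply: (h2P h u0 v0 _ _ Uu0 Vv0 (stateP hG x bt Uu0 Vv0)).1; rewrite ltW.
have [u Uu uP] := upper_dpp_le x (h3P h (introT andP (conj h0 hh3))) h0 bt th Vv0
  (mulr_gt0 h0 e0).
have ty := stateP hG x bt Uu Vv0.
have [_ /=] := h2P h u v0 _ (introT andP (conj (ltW h0) hh2)) Uu Vv0 ty.
have [DP _] := h1P h u v0 _ (introT andP (conj h0 hh1)) Uu Vv0 ty (H + e).
have {}DP := DP (fun r r01 => cP _ (U_val a Uu (box_axis_itv bt th h0 r01))).
have he : h * (dt (t, x) 0 a + (H + e) + e) = - (h * e) - h * e by rewrite /e; field.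
rewrite he in DP; have he0 := mulr_gt0 h0 e0.
by move: DP uP; rewrite /=; lra.
Qed.

Lemma upper_value_supersolution omega dt dx t x a :
  C1_with_gradient [set z : 'rV[R]_m * 'rV[R]_n | box 0 T z.1] omega dt dx ->
  box 0 T t -> t 0 a < T 0 a ->
  (\forall z \near within [set z : 'rV[R]_m * 'rV[R]_n | box 0 T z.1] (nbhs (t, x)),
    upper_value G t x - omega (t, x) <= upper_value G z.1 z.2 - omega z) ->
  dt (t, x) 0 a + upper_hamiltonian G a t x (dx (t, x)) <= 0.
Proof.
move=> domega bt ta omin; rewrite leNgt; apply/negP.
set H := upper_hamiltonian _ _ _ _ _; set P := dx (t, x) => gt0.
(* One more [e] than in the subsolution case, because the Borel selection replies to a nearby
   control value. *)
pose e := (dt (t, x) 0 a + H) / 5.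
have e0 : 0 < e by rewrite divr_gt0.
have [B BP] := pre_hamiltonian_bounded hG a P.
have VU c : vvals G c -> exists2 b, uvals G b & H - e <= pre_hamiltonian G a P t x b c.
  move=> Vc; have [b0 Ub0] := uvals_neq0 hG.
  have Hle : H <= sup [set pre_hamiltonian G a P t x b c | b in uvals G].
    apply: ge_inf; last by exists c.
    exists (- B) => _ [c' Vc' <-].
    apply: (@le_trans _ _ (pre_hamiltonian G a P t x b0 c')).
      by have := BP t x b0 c' bt Ub0 Vc'; rewrite ler_norml => /andP[].
    apply: ub_le_sup; last by exists b0.
    exists B => _ [b' Ub' <-].
    exact: le_trans (ler_norm _) (BP t x b' c' bt Ub' Vc').
  have [||_ [b Ub <-] lt] := @sup_gt R [set pre_hamiltonian G a P t x b c
      | b in uvals G] (H - e).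
  - by exists (pre_hamiltonian G a P t x b0 c), b0.
  - by apply: lt_le_trans Hle; rewrite ltrBlDr ltrDl.
  by exists b => //; exact: ltW.
have [d d0 dP] := pre_hamiltonian_unif_continuous hG a P e0.
have [f [fU mf fP]] := borel_selection (vvals_compact hG) (uvals_neq0 hG) d0 VU.
have {}fP c : vvals G c -> H - 2 * e <= pre_hamiltonian G a P t x (f c) c.
  move=> Vc; have [c' [Vc' cc' fcc']] := fP c Vc.
  have : `|pre_hamiltonian G a P t x (f c) c - pre_hamiltonian G a P t x (f c) c'| < e.
    by apply: dP; rewrite ?subrr ?normr0.
  by rewrite ltr_norml; move: fcc'; lra.
(* The reply at [s] depends on the value of [v] at [s] alone, which makes it nonanticipating. *)
pose Phi1 v : 'I_m -> 'rV[R]_m -> 'rV[R]_p := fun b s => f (v b s).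
have sPhi1 : ustrategy G t Phi1.
  split=> [v Vv b|v v' tau _ _ _ vv' b s bs]; last by rewrite /Phi1 vv'.
  by split; [exact: (borel_fun_comp mf (Vv b).1)|move=> s _; exact: fU].
have [h1 h10 h1P] := axis_step_estimate hG x bt ta e0 domega.
have [h2 h20 h2P] := near_axis_step hG bt ta omin.
have [h3 h30 h3P] := causal_step_small a.
pose h := Num.min h1 (Num.min h2 h3) / 2.
have hmin0 : 0 < Num.min h1 (Num.min h2 h3) by rewrite !lt_min h10 h20.
have h0 : 0 < h by rewrite divr_gt0.
have : h < Num.min h1 (Num.min h2 h3) by rewrite ltr_pdivrMr// mulr_natr mulr2n ltrDl.
rewrite !lt_min => /and3P[hh1 hh2 hh3].
have [u0 Uu0] := U_neq0 t; have [v0 Vv0] := V_neq0 t.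
have th : t 0 a + h <= T 0 a.
  by apply: (h2P h u0 v0 _ _ Uu0 Vv0 (stateP hG x bt Uu0 Vv0)).1; rewrite ltW.
have [u [v [Uu Vv uE uP]]] := upper_dpp_ge x (h3P h (introT andP (conj h0 hh3))) h0 bt th
  sPhi1 (mulr_gt0 h0 e0).
have ty := stateP hG x bt Uu Vv.
have [_ /=] := h2P h u v _ (introT andP (conj (ltW h0) hh2)) Uu Vv ty.
have [_ DP] := h1P h u v _ (introT andP (conj h0 hh1)) Uu Vv ty (H - 2 * e).
have {}DP := DP _.
have kP r : 0 < r < 1 -> H - 2 * e <= pre_hamiltonian G a P t x
    (u a (axis_step t a (r * h))) (v a (axis_step t a (r * h))).
  move=> r01; have /andP[r0 r1] := r01; rewrite uE.
    by apply: fP; exact: (V_val a Vv (box_axis_itv bt th h0 r01)).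
  by rewrite mulr_ge0 ?ltW//= gtr_pMl.
have {}DP := DP kP.
have he : h * (dt (t, x) 0 a + (H - 2 * e) - e) = h * e + h * e by rewrite /e; field.
rewrite he in DP; have he0 := mulr_gt0 h0 e0.
by move: DP uP; rewrite /=; lra.
Qed.

(** * The terminal condition *)

Lemma payoff_horizon x u v : U G T u -> V G T v -> payoff G T x u v = terminal G x.
Proof.
have bT : box 0 T T.
  by move=> a; rewrite lexx mxE ltW//; exact: horizon_gt0 hG a.
move=> Uu Vv; rewrite /payoff (trajectory_start _ (stateP hG x bT Uu Vv))//.
rewrite [X in X + _](_ : _ = 0) ?add0r//; apply: big1 => a _.
under eq_Rintegral do rewrite line_integrand_segment !mxE subrr mulr0.
by rewrite Rintegral_cst// mul0r.
Qed.

Lemma upper_value_horizon x : upper_value G T x = terminal G x.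
Proof.
rewrite /upper_value (_ : [set _ | _ in _] = [set terminal G x]) ?sup1//.
have infE Phi : ustrategy G T Phi ->
    inf [set payoff G T x (Phi v) v | v in V G T] = terminal G x.
  move=> [PhiU _]; rewrite (_ : [set _ | _ in _] = [set terminal G x]) ?inf1//.
  apply/seteqP; split => [_ [v Vv <-]|_ ->] /=.
    by apply: payoff_horizon => //; exact: PhiU.
  have [v Vv] := V_neq0 T; exists v => //.
  by apply: payoff_horizon => //; exact: PhiU.
apply/seteqP; split => [_ [Phi sPhi <-]|_ ->] /=; first exact: infE.
by have [Phi sPhi] := ustrategy_neq0 T; exists Phi => //; exact: infE.
Qed.

End UpperValue.

(** * The lower value by duality *)

Section Duality.
Context {R : realType} {m n p q : nat}.
Variable G : game R m n p q.
Hypothesis hG : standing_assumptions G.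
Local Notation T := (horizon G).
Implicit Types (t s : 'rV[R]_m) (x P : 'rV[R]_n) (a : 'I_m).
Implicit Types (u : 'I_m -> 'rV[R]_m -> 'rV[R]_p) (v : 'I_m -> 'rV[R]_m -> 'rV[R]_q).
Implicit Types (y : 'rV[R]_m -> 'rV[R]_n).

(** The teams are exchanged and the payoff changes sign while the dynamics are kept, so trajectories
    are the same and a strategy of the v-team becomes one of the maximizing team. *)
Definition dual_game : game R m n q p := Game (horizon G) (vvals G) (uvals G)
  (fun a t x c b => dyn G a t x b c) (fun a t x c b => - cost G a t x b c)
  (fun x => - terminal G x).

Lemma line_integralN (F : 'I_m -> 'rV[R]_m -> R) gamma : line_integrable F gamma ->
  line_integrable (fun a s => - F a s) gamma /\
  line_integral (fun a s => - F a s) gamma = - line_integral F gamma.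
Proof.
move=> /(line_integralZ (- 1)); rewrite mulN1r.
by under eq_fun do under eq_fun do rewrite mulN1r.
Qed.

Lemma dual_standing_assumptions : standing_assumptions dual_game.
Proof.
split=> /=.
- exact: horizon_gt0 hG.
- exact: vvals_compact hG.
- exact: vvals_neq0 hG.
- exact: uvals_compact hG.
- exact: uvals_neq0 hG.
- move=> a; have [C CP] := dyn_bounded hG a.
  by exists C => t x c b bt Vc Ub; exact: CP.
- move=> a e e0; have [d d0 dP] := dyn_unif_continuous hG a e0.
  by exists d => // *; exact: dP.
- move=> a; have [K KP] := dyn_lipschitz hG a.
  by exists K => t x x' c b bt Vc Ub; exact: KP.
- move=> a; have [C CP] := cost_bounded hG a.
  by exists C => t x c b bt Vc Ub; rewrite normrN; exact: CP.
- move=> a e e0; have [d d0 dP] := cost_unif_continuous hG a e0.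
  by exists d => // *; rewrite -opprD normrN; exact: dP.
- move=> a; have [K KP] := cost_lipschitz hG a.
  by exists K => t x x' c b bt Vc Ub; rewrite -opprD normrN; exact: KP.
- have [C CP] := terminal_bounded hG; exists C => x.
  by rewrite normrN.
- have [K KP] := terminal_lipschitz hG; exists K => x x'.
  by rewrite -opprD normrN.
(* Trajectories of the two games are convertible. *)
- by move=> t x v u bt Vv Uu; exact: (game_m_flow hG x bt Uu Vv).
- move=> t x v u y bt Vv Uu ty.
  have [c cP] := game_path_independent hG bt Uu Vv ty.
  exists (- c) => gamma /cP [Fi <-].
  exact: line_integralN Fi.
Qed.

Lemma dual_payoff t x u v : box 0 T t -> U G t u -> V G t v ->
  payoff dual_game t x v u = - payoff G t x u v.
Proof.
move=> bt Uu Vv; rewrite /payoff opprD; congr (_ + _).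
have Fi := running_cost_integrable hG bt Uu Vv (stateP hG x bt Uu Vv)
  (box_end (box_ge bt)).
exact: (line_integralN Fi).2.
Qed.

Lemma sup_opp_image I (A : set I) (f : I -> R) :
  sup [set - f i | i in A] = - inf [set f i | i in A].
Proof. by rewrite /inf opprK image_comp. Qed.

Lemma inf_opp_image I (A : set I) (f : I -> R) :
  inf [set - f i | i in A] = - sup [set f i | i in A].
Proof.
rewrite /inf image_comp; congr (- sup _).
by apply: eq_imagel => i _; rewrite /= opprK.
Qed.

Lemma lower_value_dual t x : box 0 T t ->
  lower_value G t x = - upper_value dual_game t x.
Proof.
move=> bt; rewrite /lower_value -[LHS]opprK -sup_opp_image; congr (- sup _).
apply: eq_imagel => Psi [PsiV _]; rewrite -inf_opp_image; congr inf.
by apply: eq_imagel => u Uu; rewrite dual_payoff//; exact: PsiV.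
Qed.

(** The gradient changes sign together with the value, hence [- P]. *)
Lemma lower_hamiltonian_dual a t x P :
  lower_hamiltonian G a t x P = - upper_hamiltonian dual_game a t x (- P).
Proof.
rewrite /lower_hamiltonian -[LHS]opprK -inf_opp_image; congr (- inf _).
apply: eq_imagel => b _; rewrite -sup_opp_image; congr sup.
apply: eq_imagel => c _; rewrite opprD; congr (_ + _).
by rewrite /dot -sumrN; apply: eq_bigr => i _; rewrite mxE mulNr.
Qed.

End Duality.

Lemma C1_with_gradientN {R : realType} {m n : nat} (D : set ('rV[R]_m * 'rV[R]_n))
    omega dt dx :
  C1_with_gradient D omega dt dx ->
  C1_with_gradient D (fun z => - omega z) (fun z => - dt z) (fun z => - dx z).
Proof.
have dotN k (w w' : 'rV[R]_k) : dot (- w) w' = - dot w w'.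
  by rewrite /dot -sumrN; apply: eq_bigr => i _; rewrite mxE mulNr.
move=> [ct cx domega]; split.
- by move=> z; apply: cvgN; exact: ct.
- by move=> z; apply: cvgN; exact: cx.
move=> z Dz e e0; apply: filterS (domega z Dz e e0) => z'.
by rewrite !dotN -!opprD normrN.
Qed.

Theorem theorem2p1 (R : realType) (m n p q : nat) (G : game R m n p q)
  (m_gt0 : (0 < m)%N) (n_gt0 : (0 < n)%N) (hG : standing_assumptions G) :
  (viscosity_solution (horizon G) (upper_hamiltonian G) (upper_value G) /\
   (forall x : 'rV[R]_n, upper_value G (horizon G) x = terminal G x)) /\
  (viscosity_solution (horizon G) (lower_hamiltonian G) (lower_value G) /\
   (forall x : 'rV[R]_n, lower_value G (horizon G) x = terminal G x)).
Proof.
split; split.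
- move=> omega dt dx domega t x bt tT; split=> near a.
    exact: upper_value_subsolution domega bt (tT a) near.
  exact: upper_value_supersolution domega bt (tT a) near.
- exact: upper_value_horizon.
(* The test function is negated along with the value: a local maximum for the lower value is a local
   minimum for the upper value of the dual game, so the two inequalities trade places. *)
- move=> omega dt dx /C1_with_gradientN domega t x bt tT.
  have hD := dual_standing_assumptions hG.
  split=> near a; rewrite lower_hamiltonian_dual.
    rewrite -oppr_le0 opprD opprK.
    have := @upper_value_supersolution _ _ _ _ _ _ hD _ _ _ _ x a domega bt (tT a).
    (* The duality of the values holds inside the box, which the restricted neighbourhood
       guarantees. *)
    rewrite mxE; apply; move: near; rewrite !near_withinE; apply: filterS => z h bz.
    have := h bz; rewrite !lower_value_dual//; lra.
  rewrite -oppr_ge0 opprD opprK.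
  have := @upper_value_subsolution _ _ _ _ _ _ hD _ _ _ _ x a domega bt (tT a).
  rewrite mxE; apply; move: near; rewrite !near_withinE; apply: filterS => z h bz.
  have := h bz; rewrite !lower_value_dual//; lra.
- move=> x; have bT : box 0 (horizon G) (horizon G).
    by move=> a; rewrite lexx mxE ltW//; exact: horizon_gt0 hG a.
  rewrite lower_value_dual// (upper_value_horizon (dual_standing_assumptions hG)).
  exact: opprK.
Qed.
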